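(* Let $(\mathcal{X},\mathcal{P})$ be a good continuous latent variable model with dimension parameter $N\ge 1$, and let $D\ge 0$ be an integer. Then $$\mathsf{CAdv}_{\le D}(\mathcal{X},\mathcal{P})^2=\mathbb{E}_{x^{(1)},x^{(2)}\sim\mathcal{X}}\ \sum_{T\subseteq[N],\,|T|\le D}\ \prod_{i\in T}R_{\mathcal{P}}(x^{(1)}_i,x^{(2)}_i)\ \le\ \mathbb{E}_{x^{(1)},x^{(2)}\sim\mathcal{X}}\ \exp^{\le D}\left(\sum_{i=1}^N R_{\mathcal{P}}(x^{(1)}_i,x^{(2)}_i)\right),$$ where $x^{(1)},x^{(2)}$ are independent draws from $\mathcal{X}$.
   Context: $[N]=\{1,\dots,N\}$ and $\exp^{\le D}(t)=\sum_{d=0}^D t^d/d!$. A continuous latent variable model (CLVM) $(\mathcal{X},\mathcal{P})$ consists of: a set $\Sigma\subseteq\mathbb{R}$ containing $0$; an integer $N\ge1$; a probability measure $\mathcal{X}$ on $\Sigma^N$ (the prior); and, for each $x\in\Sigma$, a probability measure $\mathcal{P}_x$ on a measurable space $\Omega$ (the channel $\mathcal{P}=(\mathcal{P}_x)_{x\in\Sigma}$). It defines two probability measures on $\Omega^N$: under $\mathbb{Q}$, the $y_i$ are i.i.d. with law $\mathcal{P}_0$; under $\mathbb{P}$, one first draws $x\sim\mathcal{X}$ and then draws $y_i\sim\mathcal{P}_{x_i}$ independently for $i\in[N]$. The CLVM is good if $\Sigma$ contains an open interval around zero and, for all $x\in\Sigma$, $\mathcal{P}_x$ is absolutely continuous with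 respect to $\mathcal{P}_0$ with $d\mathcal{P}_x/d\mathcal{P}_0\in L^2(\mathcal{P}_0)$. As a standing assumption for good models, $\mathbb{P}$ is absolutely continuous with respect to $\mathbb{Q}$ with $d\mathbb{P}/d\mathbb{Q}\in L^2(\mathbb{Q})$. The channel overlap is, for $x^{(1)},x^{(2)}\in\Sigma$, $R_{\mathcal{P}}(x^{(1)},x^{(2)})=\mathbb{E}_{y\sim\mathcal{P}_0}\left[\left(\frac{d\mathcal{P}_{x^{(1)}}}{d\mathcal{P}_0}(y)-1\right)\left(\frac{d\mathcal{P}_{x^{(2)}}}{d\mathcal{P}_0}(y)-1\right)\right]$. For $T\subseteq[N]$, $V_T\subseteq L^2(\mathbb{Q})$ is the subspace of functions $f(y)$ depending only on $y_T=(y_i)_{i\in T}$, and $V_{\le D}=\sum_{T\subseteq[N],|T|\le D}V_T$. The coordinate advantage is $\mathsf{CAdv}_{\le D}(\mathcal{X},\mathcal{P})=\max\{\mathbb{E}_{y\sim\mathbb{P}}f(y): f\in V_{\le D},\ \mathbb{E}_{y\sim\mathbb{Q}}f(y)^2\le1\}$. *)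

(* Defs.v *)
From HB Require Import structures.
From mathcomp Require Import all_boot all_order all_algebra.
From mathcomp Require Import all_classical all_reals all_analysis.
From mathcomp Require Import measurable_realfun.

Set Implicit Arguments.
Unset Strict Implicit.
Unset Printing Implicit Defensive.
Import Order.TTheory GRing.Theory Num.Theory.
Import numFieldNormedType.Exports.

Local Open Scope classical_set_scope.
Local Open Scope ring_scope.
Local Open Scope ereal_scope.
Local Open Scope charge_scope.

(* The alphabet Sigma as a measurable space, with the trace of the Borel sets
   of R.  Measurable spaces are pointed in the library, hence the proof of
   [Sigma 0] carried by the type; [point] is the letter 0. *)
Section alphabet.
Context {R : realType} {Sigma : set R}.

Definition alphabet (Sigma0 : Sigma 0%R) : Type := set_type Sigma.

Variable Sigma0 : Sigma 0%R.

Definition letter0 : alphabet Sigma0 := SigSub (mem_set Sigma0).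

HB.instance Definition _ := Choice.on (alphabet Sigma0).
HB.instance Definition _ := isPointed.Build (alphabet Sigma0) letter0.

Definition letter_val (a : alphabet Sigma0) : R := set_val a.

Definition alphabet_measurable : set (set (alphabet Sigma0)) :=
  preimage_set_system [set: alphabet Sigma0] letter_val measurable.

Let sigma_alphabet : sigma_algebra [set: alphabet Sigma0] alphabet_measurable.
Proof. exact/sigma_algebra_preimage/sigma_algebra_measurable. Qed.

Let alphabet_set0 : alphabet_measurable set0.
Proof. by case: sigma_alphabet. Qed.

Let alphabet_setC A : alphabet_measurable A -> alphabet_measurable (~` A).
Proof. by rewrite -setTD; case: sigma_alphabet => _ + _; exact. Qed.

Let alphabet_bigcup (F : (set (alphabet Sigma0))^nat) :
  (forall i, alphabet_measurable (F i)) -> alphabet_measurable (\bigcup_i F i).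
Proof. by case: sigma_alphabet => _ _; exact. Qed.

HB.instance Definition _ := @isMeasurable.Build (preimage_display letter_val)
  (alphabet Sigma0) alphabet_measurable
  alphabet_set0 alphabet_setC alphabet_bigcup.

End alphabet.

Section product_law.
Context d (T : measurableType d) (R : realType).

Definition tuple_cons n (p : T * n.-tuple T) : n.+1.-tuple T :=
  [tuple of p.1 :: p.2].

Lemma measurable_tuple_cons n :
  measurable_fun [set: T * n.-tuple T] (@tuple_cons n).
Proof. exact: measurable_cons. Qed.

HB.instance Definition _ n :=
  isMeasurableFun.Build _ _ _ _ (@tuple_cons n) (@measurable_tuple_cons n).

Fixpoint product_law n : ('I_n -> probability T R) ->
    probability (n.-tuple T) R :=
  match n with
  | 0%N => fun=> \d_([tuple] : 0.-tuple T)
  | m.+1 => fun mu => distribution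
      (mu ord0 \x product_law (fun i => mu (lift ord0 i))) (@tuple_cons m)
  end.

Lemma product_law_box n (mu : 'I_n -> probability T R) (A : 'I_n -> set T) :
  (forall i, measurable (A i)) ->
  product_law mu [set y | forall i, A i (tnth y i)] = \prod_(i < n) mu i (A i).
Proof.
elim: n mu A => [|n IH] mu A mA.
  by rewrite big_ord0 /= diracE mem_set// => -[].
rewrite big_ord_recl -IH//= /distribution /pushforward -product_measure1E//.
  congr (_ _); apply/seteqP; split => -[a s] /=.
    move=> h; split => [|i]; first exact: (h ord0).
    by have := h (lift ord0 i); rewrite tnthS.
  by move=> [a0 h] i; case: (unliftP ord0 i) => [j|] -> //; rewrite tnthS.
rewrite [X in measurable X](_ : _ =
    \bigcap_(i in [set: 'I_n]) ((tnth (T:=T))^~ i @^-1` A (lift ord0 i))).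
  apply: fin_bigcap_measurable => // i _.
  by rewrite -[X in measurable X]setTI; exact: measurable_tnth.
by apply/seteqP; split => y /= h i; [move=> _; exact: h|exact: (h i I)].
Qed.

End product_law.

Section family_kernel.
Context d d' (X : measurableType d) (Y : measurableType d') (R : realType).
Variable k : X -> probability Y R.
Hypothesis mk : forall U, measurable U -> measurable_fun [set: X] (k ^~ U).

Definition family_kernel & (forall U, measurable U ->
    measurable_fun [set: X] (k ^~ U)) : X -> {measure set Y -> \bar R} := k.

HB.instance Definition _ := isKernel.Build _ _ _ _ _ (family_kernel mk) mk.

Let family_kernelT x : family_kernel mk x [set: Y] = 1.
Proof. exact: probability_setT. Qed.

HB.instance Definition _ :=
  Kernel_isProbability.Build _ _ _ _ _ (family_kernel mk) family_kernelT.

End family_kernel.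

Lemma measurable_product_law d d' (S : measurableType d) (T : measurableType d')
    (R : realType) (k : S -> probability T R)
    (mk : forall U, measurable U -> measurable_fun [set: S] (k ^~ U))
    n (U : set (n.-tuple T)) : measurable U ->
  measurable_fun [set: n.-tuple S]
    (fun x => product_law (fun i => k (tnth x i)) U).
Proof.
elim: n U => [|n IH] U mU; first exact: measurable_cst.
pose tl (x : n.+1.-tuple S) := [tuple of behead x].
have tlE (x : n.+1.-tuple S) : (fun i => k (tnth (tl x) i)) =
    (fun i => k (tnth x (lift ord0 i))).
  by apply/funext => i; rewrite {2}(tuple_eta x) tnthS.
have mk0 V : measurable V ->
    measurable_fun [set: n.+1.-tuple S] (fun x => k (tnth x ord0) V).
  by move=> mV; apply: (measurableT_comp (mk V mV)); exact: measurable_tnth.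
have mk1 V : measurable V ->
    measurable_fun [set: n.+1.-tuple S * T]
      (fun p => product_law (fun i => k (tnth (tl p.1) i)) V).
  move=> mV; apply: (measurableT_comp (IH V mV)).
  by apply: (measurableT_comp (@measurable_behead _ S n)).
pose l := family_kernel mk0.
pose l' := @family_kernel _ _ _ _ R
  (fun p => product_law (fun i => k (tnth (tl p.1) i))) mk1.
pose W : set ((n.+1.-tuple S * T) * n.-tuple T) :=
  (fun p => tuple_cons (p.1.2, p.2)) @^-1` U.
have mW : measurable W.
  rewrite -[W]setTI.
  have mc : measurable_fun setT
      (fun p : (n.+1.-tuple S * T) * n.-tuple T => tuple_cons (p.1.2, p.2)).
    apply: measurable_cons => /=; last exact: measurable_snd.
    exact: (measurableT_comp measurable_snd).
  exact: mc.
have mf : measurable_fun [set: n.+1.-tuple S * T]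
    (fun p => l' p (xsection W p)).
  by apply: measurable_fun_xsection_finite_kernel; rewrite inE.
have := measurable_fun_integral_finite_kernel _ l (fun=> measure_ge0 _ _) mf.
apply: eq_measurable_fun => x _.
rewrite /= /distribution /pushforward /product_measure1 /l /l' /=.
apply: eq_integral => y _ /=; rewrite /family_kernel tlE.
by congr (_ _); apply/seteqP; split => s; rewrite /xsection /= !inE.
Qed.

Section mixture.
Context d d' (S : measurableType d) (T : measurableType d') (R : realType).
Variables (X : probability S R) (k : S -> probability T R).
Hypothesis mk : forall U, measurable U -> measurable_fun [set: S] (k ^~ U).

Definition mixture & (forall U, measurable U ->
    measurable_fun [set: S] (k ^~ U)) : set T -> \bar R :=
  fun A => \int[X]_x k x A.

Let mixture0 : mixture mk set0 = 0.
Proof. by rewrite /mixture integral0_eq. Qed.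

Let mixture_ge0 A : 0 <= mixture mk A.
Proof. exact: integral_ge0. Qed.

Let mixture_sigma_additive : semi_sigma_additive (mixture mk).
Proof.
move=> F mF tF mUF; rewrite [X in _ --> X](_ : _ = \sum_(n <oo) mixture mk (F n)).
  by apply: is_cvg_ereal_nneg_natsum.
rewrite /mixture -integral_nneseries//; last by move=> n; exact: mk.
apply: eq_integral => x _; rewrite measure_bigcup//.
by apply: eq_eseriesl => i; rewrite in_setT.
Qed.

HB.instance Definition _ := isMeasure.Build _ _ _ (mixture mk)
  mixture0 mixture_ge0 mixture_sigma_additive.

Let mixtureT : mixture mk [set: T] = 1.
Proof.
transitivity (\int[X]_(x in setT) cst 1 x).
  by apply: eq_integral => x _; exact: probability_setT.
by rewrite integral_cst// mul1e; exact: probability_setT.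
Qed.

HB.instance Definition _ :=
  Measure_isProbability.Build _ _ _ (mixture mk) mixtureT.

End mixture.
Arguments mixture {d d' S T R} X k _ _.

Definition density d (T : measurableType d) (R : realType)
    (nu mu : probability T R) : T -> R :=
  fine \o 'd (charge_of_finite_measure nu) '/d mu.

Section clvm.
Context {R : realType} {Sigma : set R} {Sigma0 : Sigma 0%R}.
Context {d : measure_display} {Omega : measurableType d}.
Variable K : R.-pker (alphabet Sigma0) ~> Omega.

Definition channel_law (a : alphabet Sigma0) : set Omega -> \bar R := K a.

Section channel_law_probability.
Variable a : alphabet Sigma0.

HB.instance Definition _ := Measure.on (channel_law a).

Let channel_lawT : channel_law a [set: Omega] = 1.
Proof. exact: prob_kernel. Qed.

HB.instance Definition _ :=
  Measure_isProbability.Build _ _ _ (channel_law a) channel_lawT.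

End channel_law_probability.

Definition likelihood_ratio (a : alphabet Sigma0) : Omega -> R :=
  density (channel_law a) (channel_law (letter0 Sigma0)).

Definition overlap (a b : alphabet Sigma0) : R :=
  fine 'E_(channel_law (letter0 Sigma0))[fun y =>
    ((likelihood_ratio a y - 1) * (likelihood_ratio b y - 1))%R].

Variable N : nat.

Definition null_law : probability (N.-tuple Omega) R :=
  product_law (fun _ : 'I_N => channel_law (letter0 Sigma0)).

Variable X : probability (N.-tuple (alphabet Sigma0)) R.

Definition observation_law (x : N.-tuple (alphabet Sigma0)) :
    probability (N.-tuple Omega) R :=
  product_law (fun i => channel_law (tnth x i)).

Lemma measurable_observation_law U : measurable U ->
  measurable_fun [set: N.-tuple (alphabet Sigma0)] (observation_law ^~ U).
Proof.
by apply: (@measurable_product_law _ _ _ _ _ (fun a => channel_law a));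
  exact: measurable_kernel.
Qed.

Definition planted_law : probability (N.-tuple Omega) R :=
  mixture X observation_law measurable_observation_law.

Definition good : Prop :=
  [/\ exists a b : R, [/\ (a < 0)%R, (0 < b)%R & `]a, b[%classic `<=` Sigma],
      forall a, channel_law a `<< channel_law (letter0 Sigma0),
      forall a, likelihood_ratio a \in Lfun (channel_law (letter0 Sigma0)) 2%:E,
      planted_law `<< null_law
    & density planted_law null_law \in Lfun null_law 2%:E].

(* A measurable function on N-tuples whose values only depend on the
   coordinates in T is a measurable function of these coordinates: fix the
   other ones. *)
Definition coordinate_space (T : {set 'I_N}) : set (N.-tuple Omega -> R) :=
  [set f | f \in Lfun null_law 2%:E /\
    forall y z : N.-tuple Omega,
      (forall i, i \in T -> tnth y i = tnth z i) -> f y = f z].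

Definition degree_space (D : nat) : set (N.-tuple Omega -> R) :=
  [set f | exists2 g : {set 'I_N} -> N.-tuple Omega -> R,
    forall T : {set 'I_N}, (#|T| <= D)%N -> coordinate_space T (g T) &
    f = fun y => (\sum_(T : {set 'I_N} | (#|T| <= D)%N) g T y)%R].

Definition test_functions (D : nat) : set (N.-tuple Omega -> R) :=
  [set f | degree_space D f /\ 'E_null_law[fun y => (f y ^+ 2)%R] <= 1].

(* A maximum when it is attained, which is not built into the definition. *)
Definition CAdv (D : nat) : \bar R :=
  ereal_sup [set 'E_planted_law[f] | f in test_functions D].

End clvm.

Definition exp_le {R : realType} (D : nat) (t : R) : R :=
  (\sum_(d < D.+1) t ^+ d / (d`!)%:R)%R.

(* Main.v *)
Require Import Defs.
From HB Require Import structures.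
From mathcomp Require Import all_boot all_order all_algebra.
From mathcomp Require Import all_classical all_reals all_analysis.
From mathcomp Require Import measurable_realfun ring lra.

Set Implicit Arguments.
Unset Strict Implicit.
Unset Printing Implicit Defensive.
Import Order.TTheory GRing.Theory Num.Theory.
Import numFieldNormedType.Exports.

Local Open Scope classical_set_scope.
Local Open Scope ring_scope.
Local Open Scope ereal_scope.

(** Let [Q] be the null law, [P] the planted law and [L] the density of [P]
    with respect to [Q]. Since [E_P f] is the inner product of [L] and [f] in
    [L^2(Q)], the largest value of [E_P f] over the unit ball of [V_{<=D}] is
    the norm of the orthogonal projection of [L] on [V_{<=D}], and it is
    attained at the normalised projection.

    The projection is explicit. For a set [S] of coordinates let [L_S] be the
    average of [L] over the coordinates outside [S] ([marginal]). The
    Efron-Stein component of [L] on [T] is the alternating sum of the [L_S]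
    over [S] included in [T] ([component]), and the projection is the sum of
    the components with at most [D] coordinates ([low_degree_part]). The proof
    rests on one fact: if [g] depends only on the coordinates in [A], then
    [E_Q (L_S g)] depends on [S] only through [S :&: A] ([marginal_test_setI]),
    so that all components but those on subsets of [A] cancel
    ([sum_parity_setI]).

    The squared norm of the projection is its expectation under [P], hence an
    alternating sum of the numbers [E_P L_S], and
    [E_P L_S = E \prod_(i in S) (1 + R(x_i, x'_i))] for independent [x], [x']
    drawn from the prior ([planted_marginal]). Expanding
    [\prod_(i in T) ((1 + R) - 1)] gives the sum over [T] of the theorem. The
    likelihood ratio of the channel is a function of a letter and an
    observation which may fail to be jointly measurable, so the two replicas
    cannot be exchanged with the observation by Tonelli's theorem. Instead
    each replica is introduced as a law: averaging under [P_x] over fresh null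
    coordinates outside [S] amounts to replacing the letters of [x] outside
    [S] by 0 ([integral_avg], [masked_law]), and densities are only ever used
    for one fixed [x] at a time.

    For the inequality, [(\sum_i R_i) ^+ d] expands over the maps from [d]
    slots to the coordinates. The injective maps give [d`!] times the sum over
    the sets of [d] coordinates ([exp_le_expand]); what remains is a positive
    combination of expectations of products of overlaps. Such a product is a
    positive semidefinite kernel in [(x, x')] by Schur's product theorem
    ([psd_prod_gram]), and an integrable positive semidefinite kernel has a
    nonnegative expectation on independent draws ([psd_integral_ge0]). Powers
    of an overlap need not be integrable, but overlaps are at least [-1], so
    the truncated exponential of their sum is bounded below: either its
    expectation is infinite and there is nothing to prove, or it is integrable
    and dominates every monomial of degree at most [D]
    ([monomial_le]). *)

(** * Integration against product laws *)

Section product_law_integrals.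
Context d (T : measurableType d) (R : realType).

Lemma prod_tuple_cons n (f : 'I_n.+1 -> T -> \bar R) a (s : n.-tuple T) :
  \prod_(i < n.+1) f i (tnth (tuple_cons (a, s)) i) =
  f ord0 a * \prod_(i < n) f (lift ord0 i) (tnth s i).
Proof.
rewrite big_ord_recl /tuple_cons/= tnth0; congr (_ * _).
by apply: eq_bigr => i _; rewrite tnthS.
Qed.

Lemma integral_product_lawS n (mu : 'I_n.+1 -> probability T R)
    (h : n.+1.-tuple T -> \bar R) :
  measurable_fun setT h -> (forall y, 0 <= h y) ->
  \int[product_law mu]_y h y = \int[mu ord0]_a
    \int[product_law (fun i => mu (lift ord0 i))]_s h (tuple_cons (a, s)).
Proof.
move=> mh h0; rewrite /= ge0_integral_distribution//.
rewrite fubini_tonelli1//.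
  by apply: measurableT_comp => //; exact: measurable_tuple_cons.
by move=> q; exact: h0.
Qed.

Lemma measurable_prod_tnth n (f : 'I_n -> T -> \bar R) :
  (forall i, measurable_fun setT (f i)) ->
  measurable_fun [set: n.-tuple T] (fun y => \prod_(i < n) f i (tnth y i)).
Proof.
move=> mf; elim: n f mf => [|n IH] f mf.
  by under eq_fun do rewrite big_ord0; exact: measurable_cst.
under eq_fun do rewrite big_ord_recl.
apply: emeasurable_funM.
  by apply: (measurableT_comp (mf ord0)); exact: measurable_tnth.
have -> : (fun y : n.+1.-tuple T =>
    \prod_(i < n) f (lift ord0 i) (tnth y (lift ord0 i))) =
    (fun s : n.-tuple T => \prod_(i < n) f (lift ord0 i) (tnth s i)) \o
    (fun y : n.+1.-tuple T => [tuple of behead y]).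
  apply/funext => y /=; apply: eq_bigr => i _.
  by rewrite {1}(tuple_eta y) tnthS.
apply: measurableT_comp; first exact: (IH _ (fun i => mf (lift ord0 i))).
exact: measurable_behead.
Qed.

Lemma integral_product_law_prod n (mu : 'I_n -> probability T R)
    (f : 'I_n -> T -> \bar R) :
  (forall i, measurable_fun setT (f i)) -> (forall i a, 0 <= f i a) ->
  \int[product_law mu]_y \prod_(i < n) f i (tnth y i) =
  \prod_(i < n) \int[mu i]_a f i a.
Proof.
elim: n mu f => [|n IH] mu f mf f0.
  rewrite big_ord0 /=; under eq_integral do rewrite big_ord0.
  by rewrite integral_cst//= diracT mul1e.
rewrite integral_product_lawS//; [|exact: measurable_prod_tnth|]; last first.
  by move=> y; exact: prode_ge0.
rewrite big_ord_recl -IH//.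
rewrite -ge0_integralZr//; last first.
  by apply: integral_ge0 => y _; exact: prode_ge0.
apply: eq_integral => a _; rewrite -ge0_integralZl//.
- by apply: eq_integral => s _; rewrite prod_tuple_cons.
- exact: (@measurable_prod_tnth n (fun i => f (lift ord0 i))).
- by move=> s _; exact: prode_ge0.
Qed.

(** Densities are tested against nonnegative functions rather than indicators:
    this is the form that combines with Tonelli's theorem. *)
Definition has_density d' (Y : measurableType d') (nu mu : probability Y R)
    (p : Y -> \bar R) :=
  forall h : Y -> \bar R, measurable_fun setT h -> (forall y, 0 <= h y) ->
    \int[nu]_y h y = \int[mu]_y (h y * p y).

(** Densities of the factors multiply. The induction peels off one coordinate
    by Tonelli's theorem, which is why the density relation is stated for all
    nonnegative test functions. *)
Lemma product_law_density n (mu nu : 'I_n -> probability T R)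
    (p : 'I_n -> T -> \bar R) :
  (forall i, measurable_fun setT (p i)) -> (forall i a, 0 <= p i a) ->
  (forall i, has_density (nu i) (mu i) (p i)) ->
  has_density (product_law nu) (product_law mu)
    (fun y => \prod_(i < n) p i (tnth y i)).
Proof.
elim: n mu nu p => [|n IH] mu nu p mp p0 nup h mh h0.
  by apply: eq_integral => y _; rewrite big_ord0 mule1.
have mhc : measurable_fun setT (fun q : T * n.-tuple T => h (tuple_cons q)).
  by apply: measurableT_comp => //; exact: measurable_tuple_cons.
rewrite !integral_product_lawS//; last 2 first.
- apply: emeasurable_funM => //; exact: measurable_prod_tnth.
- by move=> y; rewrite mule_ge0// prode_ge0.
have mI : measurable_fun setT (fun a =>
    \int[product_law (fun i => nu (lift ord0 i))]_s h (tuple_cons (a, s))).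
  exact: (measurable_fun_fubini_tonelli_F (fun q => h (tuple_cons q))).
rewrite nup//; last by move=> a; exact: integral_ge0.
apply: eq_integral => a _.
have mha : measurable_fun setT (fun s : n.-tuple T => h (tuple_cons (a, s))).
  by apply: (measurableT_comp mhc); exact: measurable_pair1.
rewrite (IH (fun i => mu (lift ord0 i)) _ (fun i => p (lift ord0 i)))//.
have mha' : measurable_fun setT (fun s : n.-tuple T =>
    h (tuple_cons (a, s)) * \prod_(i < n) p (lift ord0 i) (tnth s i)).
  apply: emeasurable_funM => //.
  exact: (@measurable_prod_tnth n (fun i => p (lift ord0 i))).
rewrite -ge0_integralZr//; last by move=> s _; rewrite mule_ge0// prode_ge0.
apply: eq_integral => s _; rewrite prod_tuple_cons -muleA; congr (_ * _).
by rewrite muleC.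
Qed.

End product_law_integrals.

(** * Exchanging coordinates between two independent samples *)
Section splicing.
Context d (T : measurableType d) (R : realType).

Definition box n (A : 'I_n -> set T) : set (n.-tuple T) :=
  [set y | forall i, A i (tnth y i)].

Lemma measurable_box n (A : 'I_n -> set T) :
  (forall i, measurable (A i)) -> measurable (box A).
Proof.
move=> mA; rewrite [X in measurable X](_ : _ =
    \bigcap_(i in [set: 'I_n]) ((tnth (T:=T))^~ i @^-1` A i)).
  apply: fin_bigcap_measurable => // i _.
  by rewrite -[X in measurable X]setTI; exact: measurable_tnth.
by apply/seteqP; split => y /= h i; [move=> _; exact: h|exact: (h i I)].
Qed.

Lemma product_laws_box n (mu nu : 'I_n -> probability T R)
    (A B : 'I_n -> set T) :
  (forall i, measurable (A i)) -> (forall i, measurable (B i)) ->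
  (product_law mu \x product_law nu) (box A `*` box B) =
  (\prod_(i < n) mu i (A i)) * \prod_(i < n) nu i (B i).
Proof.
move=> mA mB; rewrite -!product_law_box// -product_measure1E//;
  exact: measurable_box.
Qed.

Lemma boxT n : box (fun=> setT) = [set: n.-tuple T].
Proof. by apply/seteqP; split => // y _ i. Qed.

(** Boxes are stable by intersection and generate the product sigma-algebra of
    a pair of tuples, each coordinate being measurable for the sigma-algebra
    they generate. *)
Lemma tuple_pair_measure_unique n
    (m1 m2 : {measure set (n.-tuple T * n.-tuple T) -> \bar R}) :
  m1 setT < +oo ->
  (forall A B : 'I_n -> set T, (forall i, measurable (A i)) ->
    (forall i, measurable (B i)) ->
    m1 (box A `*` box B) = m2 (box A `*` box B)) ->
  forall U, measurable U -> m1 U = m2 U.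
Proof.
move=> m1T m12.
pose G : set (set (n.-tuple T * n.-tuple T)) :=
  [set C | exists A B : 'I_n -> set T, [/\ forall i, measurable (A i),
     forall i, measurable (B i) & C = box A `*` box B]].
have GT : G setT.
  by exists (fun=> setT), (fun=> setT); split=> //; rewrite !boxT setXTT.
apply: (measure_unique G (fun=> setT)) => //.
- apply/seteqP; split; last first.
    apply: smallest_sub; first exact: sigma_algebra_measurable.
    by move=> _ [A [B [mA mB ->]]]; apply: measurableX; exact: measurable_box.
  (* The identity, from the sigma-algebra generated by boxes. *)
  pose f (p : g_sigma_algebraType G) : n.-tuple T * n.-tuple T := p.
  suff mf : measurable_fun setT f.
    by move=> U mU; have := mf measurableT U mU; rewrite setTI.
  apply/measurable_fun_pairP; split; apply/measurable_fun_tnthP => i _ A mA;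
    apply: sub_sigma_algebra; rewrite setTI.
  + exists (fun j => if j == i then A else setT), (fun=> setT); split => //.
      by move=> j; case: ifP.
    rewrite boxT; apply/seteqP; split => -[y z] /=.
      by move=> Ay; split=> // j; case: eqP => // ->.
    by move=> [/(_ i)]; rewrite eqxx.
  + exists (fun=> setT), (fun j => if j == i then A else setT); split => //.
      by move=> j; case: ifP.
    rewrite boxT; apply/seteqP; split => -[y z] /=.
      by move=> Ay; split=> // j; case: eqP => // ->.
    by move=> [_ /(_ i)]; rewrite eqxx.
- move=> _ _ [A [B [mA mB ->]]] [A' [B' [mA' mB' ->]]].
  exists (fun i => A i `&` A' i), (fun i => B i `&` B' i); split.
  + by move=> i; exact: measurableI.
  + by move=> i; exact: measurableI.
  + apply/seteqP; split => -[y z] /=.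
      by move=> [[Ay Bz] [Ay' Bz']]; split=> i; split.
    by move=> [AA BB]; split; split=> i; have [] := AA i; have [] := BB i.
- by apply/seteqP; split => // p _; exists 0%N.
- by move=> C [A [B [mA mB ->]]]; exact: m12.
Qed.

Definition splice n (S : {set 'I_n}) (y z : n.-tuple T) : n.-tuple T :=
  [tuple if i \in S then tnth y i else tnth z i | i < n].

Definition splice_law n (S : {set 'I_n}) (mu nu : 'I_n -> probability T R) i :=
  if i \in S then mu i else nu i.

Lemma measurable_splice n (S : {set 'I_n}) :
  measurable_fun setT (fun p : n.-tuple T * n.-tuple T => splice S p.1 p.2).
Proof.
apply/measurable_fun_tnthP => i; rewrite /splice/=.
have [iS|iS] := boolP (i \in S).
  rewrite (_ : _ \o _ = (fun y => tnth y i) \o fst).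
    by apply: measurableT_comp => //; exact: measurable_tnth.
  by apply/funext => p /=; rewrite tnth_mktuple iS.
rewrite (_ : _ \o _ = (fun y => tnth y i) \o snd).
  by apply: measurableT_comp => //; exact: measurable_tnth.
by apply/funext => p /=; rewrite tnth_mktuple (negPf iS).
Qed.

Definition swap_outside n (S : {set 'I_n}) (p : n.-tuple T * n.-tuple T) :=
  (splice S p.1 p.2, splice S p.2 p.1).

Lemma measurable_swap_outside n (S : {set 'I_n}) :
  measurable_fun setT (@swap_outside n S).
Proof.
apply: measurable_fun_pair; first exact: measurable_splice.
apply: (@measurableT_comp _ _ _ _ _ _ (fun p => splice S p.1 p.2) _
  (fun p : n.-tuple T * n.-tuple T => (p.2, p.1))).
  exact: measurable_splice.
exact: measurable_swap.
Qed.

HB.instance Definition _ n S := isMeasurableFun.Build _ _ _ _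
  (@swap_outside n S) (@measurable_swap_outside n S).

(** Exchanging the coordinates outside [S] of two independent samples yields
    two independent samples from the exchanged product laws; boxes are mapped
    to boxes, so comparing products of [N] factors suffices. This symmetry
    carries both [integral_avg] and [avg_selfadjoint]. *)
Lemma swap_outside_law n (S : {set 'I_n}) (mu nu : 'I_n -> probability T R)
    U : measurable U ->
  distribution (product_law mu \x product_law nu) (@swap_outside n S) U =
  (product_law (splice_law S mu nu) \x product_law (splice_law S nu mu)) U.
Proof.
apply: tuple_pair_measure_unique.
  apply: (@le_lt_trans _ _ 1); last exact: ltry.
  exact: (@probability_le1 _ _ _
    (distribution (product_law mu \x product_law nu) (@swap_outside n S))).
move=> A B mA mB; rewrite [RHS]product_laws_box//.
transitivity ((product_law mu \x product_law nu)
  (@swap_outside n S @^-1` (box A `*` box B))); first by [].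
rewrite (_ : _ @^-1` _ = box (fun i => if i \in S then A i else B i) `*`
    box (fun i => if i \in S then B i else A i)); last first.
  apply/seteqP; split => -[y z] [/= h1 h2]; split=> i /=;
    by have := h1 i; have := h2 i; rewrite !tnth_mktuple/=; case: ifP.
rewrite product_laws_box; [|by move=> i; case: ifP..].
rewrite -!big_split/=; apply: eq_bigr => i _.
by rewrite /splice_law; case: ifP => // _; rewrite muleC.
Qed.

Lemma integral_swap_outside n (S : {set 'I_n})
    (mu nu : 'I_n -> probability T R) (h : n.-tuple T * n.-tuple T -> \bar R) :
  measurable_fun setT h -> (forall p, 0 <= h p) ->
  \int[product_law mu]_y \int[product_law nu]_z
    h (splice S y z, splice S z y) =
  \int[product_law (splice_law S mu nu)]_y
    \int[product_law (splice_law S nu mu)]_z h (y, z).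
Proof.
move=> mh h0.
rewrite -(fubini_tonelli1 (h \o @swap_outside n S))//; last 2 first.
- by apply: measurableT_comp => //; exact: measurable_swap_outside.
- by move=> p; exact: h0.
rewrite -fubini_tonelli1//.
transitivity (\int[distribution (product_law mu \x product_law nu)
    (@swap_outside n S)]_p h p).
  by rewrite ge0_integral_distribution.
by apply: eq_measure_integral => U mU _; exact: swap_outside_law.
Qed.

End splicing.

(** * Averaging over the coordinates outside a set *)
Lemma integral_cst_probability d (T : measurableType d) (R : realType)
    (P : probability T R) (c : \bar R) : \int[P]_x c = c.
Proof.
rewrite (_ : (fun=> c) = cst c)// integral_cst// -[RHS]mule1.
by congr (_ * _); exact: probability_setT.
Qed.

Section averaging.
Context d (T : measurableType d) (R : realType).
Variables (n : nat) (nu : 'I_n -> probability T R).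
Implicit Types (S : {set 'I_n}) (f g : n.-tuple T -> \bar R).

(** The conditional expectation of [f] given the coordinates in [S], under the
    product of the [nu i]; this version depends on these coordinates
    everywhere and not merely almost everywhere. *)
Definition avg S f (y : n.-tuple T) : \bar R :=
  \int[product_law nu]_z f (splice S y z).

Definition depends_only_on (U : Type) S (f : n.-tuple T -> U) :=
  forall y z, (forall i, i \in S -> tnth y i = tnth z i) -> f y = f z.

Lemma avg_ge0 S f : (forall y, 0 <= f y) -> forall y, 0 <= avg S f y.
Proof. by move=> f0 y; exact: integral_ge0. Qed.

Lemma measurable_avg S f : measurable_fun setT f -> (forall y, 0 <= f y) ->
  measurable_fun setT (avg S f).
Proof.
move=> mf f0.
apply: (measurable_fun_fubini_tonelli_F (fun p => f (splice S p.1 p.2))) => //.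
by apply: (measurableT_comp mf); exact: measurable_splice.
Qed.

Lemma avg_depends_only_on S f : depends_only_on S (avg S f).
Proof.
move=> y z yz; apply: eq_integral => w _; congr (f _).
by apply: eq_from_tnth => i; rewrite !tnth_mktuple; case: ifP => // /yz.
Qed.

Lemma avg_id S f : depends_only_on S f -> avg S f = f.
Proof.
move=> fS; apply/funext => y; rewrite /avg.
under eq_integral => z _.
  rewrite (fS _ y); last by move=> i iS; rewrite tnth_mktuple iS.
  over.
exact: integral_cst_probability.
Qed.

(** Averaging moves from the function to the law: the coordinates outside [S]
    get resampled from [nu]. *)
Lemma integral_avg S (mu : 'I_n -> probability T R) f :
  measurable_fun setT f -> (forall y, 0 <= f y) ->
  \int[product_law mu]_y avg S f y = \int[product_law (splice_law S mu nu)]_y f y.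
Proof.
move=> mf f0.
rewrite (integral_swap_outside S mu nu (h := fun p => f p.1))//; last first.
  exact: (measurableT_comp mf).
by apply: eq_integral => y _; exact: (integral_cst_probability _ (f y)).
Qed.

Lemma splice_lawid S (mu : 'I_n -> probability T R) : splice_law S mu mu = mu.
Proof. by apply/funext => i; rewrite /splice_law; case: ifP. Qed.

(** Both sides are integrals of [f] at one sample times [g] at the other, the
    two samples sharing their coordinates in [S]. *)
Lemma avg_selfadjoint S f g : measurable_fun setT f -> measurable_fun setT g ->
  (forall y, 0 <= f y) -> (forall y, 0 <= g y) ->
  \int[product_law nu]_y (avg S f y * g y) =
  \int[product_law nu]_y (f y * avg S g y).
Proof.
move=> mf mg f0 g0.
have ms := @measurable_splice _ T n S.
have mS f' : measurable_fun setT f' ->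
    forall y, measurable_fun setT (fun z => f' (splice S y z)).
  move=> mf' y.
  apply: (measurableT_comp mf' (g := fun z => splice S y z)).
  exact: (measurableT_comp ms (measurable_pair1 y)).
transitivity (\int[product_law nu]_y \int[product_law nu]_z
    (f (splice S y z) * g y)).
  by apply: eq_integral => y _; rewrite ge0_integralZr//; exact: mS.
pose h p := f p.1 * g (splice S p.1 p.2).
transitivity (\int[product_law nu]_y \int[product_law nu]_z
    h (splice S y z, splice S z y)).
  apply: eq_integral => y _; apply: eq_integral => z _; rewrite /h/=; congr (_ * g _).
  by apply: eq_from_tnth => i; rewrite !tnth_mktuple; case: (i \in S).
rewrite integral_swap_outside; last 2 first.
- apply: emeasurable_funM; first exact: (measurableT_comp mf).
  exact: (measurableT_comp mg).
- by move=> p; rewrite mule_ge0.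
rewrite !splice_lawid; apply: eq_integral => y _.
by rewrite /h/= ge0_integralZl//; exact: mS.
Qed.

End averaging.

(** * Densities, mixtures and square integrable functions *)
Section probability_facts.
Context d (T : measurableType d) (R : realType).
Implicit Types P : probability T R.

(** The square of the integral is the integral of [h y * h z] over independent
    [y] and [z], and [2 h y h z <= h y ^+ 2 + h z ^+ 2]. This form of the
    Cauchy-Schwarz inequality allows infinite values on both sides. *)
Lemma sqr_integral_le P (h : T -> R) : measurable_fun setT h ->
  (forall y, 0 <= h y)%R ->
  (\int[P]_y (h y)%:E) * (\int[P]_y (h y)%:E) <= \int[P]_y (h y ^+ 2)%:E.
Proof.
move=> mh h0.
have mE : measurable_fun setT (EFin \o h) by exact/measurable_EFinP.
have mE2 : measurable_fun setT (EFin \o (fun y => h y ^+ 2 / 2)%R).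
  by apply/measurable_EFinP/measurable_funM => //; exact: measurable_funX.
have h0E y : 0 <= (h y)%:E by rewrite lee_fin.
have h2 y : (0 <= h y ^+ 2 / 2 :> R)%R by rewrite divr_ge0// sqr_ge0.
set I2 := (leRHS).
have half : \int[P]_y (h y ^+ 2 / 2)%:E + \int[P]_y (h y ^+ 2 / 2)%:E = I2.
  rewrite -ge0_integralD//; try by move=> y _; rewrite lee_fin.
  by apply: eq_integral => y _; rewrite -EFinD -splitr.
rewrite -half -ge0_integralZr//; last exact: integral_ge0.
rewrite -[X in _ + X](integral_cst_probability P) -ge0_integralD//; last 2 first.
- by move=> y _; rewrite lee_fin.
- by move=> y _; apply: integral_ge0 => z _; rewrite lee_fin.
apply: ge0_le_integral => //.
- by move=> y _; rewrite mule_ge0//; exact: integral_ge0.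
- by apply: emeasurable_funM.
- by apply: emeasurable_funD.
move=> y _; rewrite -ge0_integralZl//.
rewrite -[X in X + _](integral_cst_probability P) -ge0_integralD//; last 2 first.
- by move=> z _; rewrite lee_fin.
- by move=> z _; rewrite lee_fin.
apply: ge0_le_integral => //.
- by move=> z _; rewrite mule_ge0.
- by apply: emeasurable_funM.
- by apply: emeasurable_funD.
move=> z _; rewrite -EFinM -EFinD lee_fin -mulrDl ler_pdivlMr// -subr_ge0.
by rewrite (_ : _ - _ = (h y - h z) ^+ 2)%R ?sqr_ge0//; ring.
Qed.

(** The Radon-Nikodym derivative is only determined almost everywhere; this
    version is nonnegative everywhere, as Tonelli's theorem requires. *)
Lemma has_densityP P P' : P `<< P' -> exists p : T -> R,
  [/\ measurable_fun setT p, forall y, (0 <= p y)%R,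
    ae_eq P' setT (EFin \o p) (EFin \o density P P') &
    has_density P P' (EFin \o p)].
Proof.
move=> PP'; pose f := Radon_Nikodym_SigmaFinite.f P P'.
have ff y : f y \is a fin_num by exact: Radon_Nikodym_SigmaFinite.f_fin_num.
have f0 y : 0 <= f y by exact: Radon_Nikodym_SigmaFinite.f_ge0.
have fE : EFin \o (fine \o f) = f by apply/funext => y /=; rewrite fineK.
have mf : measurable_fun setT f.
  exact: measurable_int (Radon_Nikodym_SigmaFinite.f_integrable PP').
exists (fine \o f); split.
- by apply/measurable_EFinP; rewrite fE.
- by move=> y /=; rewrite fine_ge0.
- rewrite fE.
  have := @ae_eq_Radon_Nikodym_SigmaFinite _ _ _ P P' PP' _ measurableT.
  apply: filterS => y /= h yT; rewrite [f y](h yT) /density/= fineK//.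
  exact: Radon_Nikodym_fin_num.
- move=> h mh h0; rewrite fE.
  by rewrite -(Radon_Nikodym_SigmaFinite.change_of_variables PP').
Qed.

End probability_facts.

(** A mixture is the composition of a constant kernel with the kernel of its
    components. *)
Lemma integral_mixture d d' (S : measurableType d) (T : measurableType d')
    (R : realType) (X : probability S R) (k : S -> probability T R)
    (mk : forall U, measurable U -> measurable_fun [set: S] (k ^~ U))
    (h : T -> \bar R) : measurable_fun setT h -> (forall y, 0 <= h y) ->
  \int[mixture X k mk]_y h y = \int[X]_x \int[k x]_y h y.
Proof.
move=> mh h0.
have m1 U : measurable U -> measurable_fun [set: unit] ((fun=> X) ^~ U).
  by move=> _; exact: measurable_cst.
have m2 U : measurable U ->
    measurable_fun [set: unit * S] ((fun p : unit * S => k p.2) ^~ U).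
  by move=> mU; exact: (measurableT_comp (mk U mU)).
have := @integral_kcomp _ _ _ _ _ _ _ (family_kernel m1) (family_kernel m2)
  tt h h0 mh.
by [].
Qed.

Section linear_combinations.
Context d (T : measurableType d) (R : realType) (P : {measure set T -> \bar R}).
Local Open Scope ring_scope.

Lemma integrable_lincomb (I : finType) (A : pred I) (c : I -> R)
    (f : I -> T -> R) :
  (forall i, A i -> P.-integrable setT (EFin \o f i)) ->
  P.-integrable setT (EFin \o (fun x => \sum_(i | A i) c i * f i x)).
Proof.
move=> intf.
have -> : EFin \o (fun x => \sum_(i | A i) c i * f i x) =
    (fun x => (\sum_(i | A i) (c i)%:E * (f i x)%:E)%E).
  by apply/funext => x /=; rewrite -sumEFin; apply: eq_bigr => i _; rewrite EFinM.
by apply: integrable_sum => // i Ai; apply: integrableZl => //; exact: intf.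
Qed.

Lemma Rintegral_lincomb (I : finType) (A : pred I) (c : I -> R)
    (f : I -> T -> R) :
  (forall i, A i -> P.-integrable setT (EFin \o f i)) ->
  \int[P]_x (\sum_(i | A i) c i * f i x) =
  \sum_(i | A i) c i * \int[P]_x f i x.
Proof.
move=> intf.
pose g i x := if A i then (c i * f i x)%:E else 0%E.
have intg i : P.-integrable setT (g i).
  rewrite /g; case: (A i) (intf i) => [/(_ isT) {}intf|_]; last exact: integrable0.
  by under eq_fun do rewrite EFinM; exact: integrableZl.
rewrite /Rintegral.
transitivity (fine (\int[P]_x \sum_(i | A i) g i x)%E).
  congr fine; apply: eq_integral => x _; rewrite -sumEFin.
  by apply: eq_bigr => i Ai; rewrite /g Ai.
rewrite integral_sum//.
transitivity (fine (\sum_(i | A i) (c i * fine (\int[P]_x (f i x)%:E)%E)%:E)%E);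
  last by rewrite sumEFin.
congr fine; apply: eq_bigr => i Ai; rewrite /g Ai.
under eq_integral do rewrite EFinM.
rewrite integralZl//; last exact: intf.
by rewrite EFinM fineK// integrable_fin_num//; exact: intf.
Qed.
Lemma Rintegral_sum (I : finType) (A : pred I) (f : I -> T -> R) :
  (forall i, A i -> P.-integrable setT (EFin \o f i)) ->
  \int[P]_x (\sum_(i | A i) f i x) = \sum_(i | A i) \int[P]_x f i x.
Proof.
move=> intf; have := @Rintegral_lincomb I A (fun=> 1) f intf.
under eq_Rintegral do under eq_bigr do rewrite mul1r.
by move=> ->; under eq_bigr do rewrite mul1r.
Qed.

End linear_combinations.

Section square_integrable.
Context d (T : measurableType d) (R : realType) (P : probability T R).
Local Open Scope ring_scope.

Lemma Lfun2_measurable (f : T -> R) : f \in Lfun P 2%:E -> measurable_fun setT f.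
Proof. by rewrite inE => /andP[/[!inE]]. Qed.

Lemma Lfun2_integrableM (f g : T -> R) : f \in Lfun P 2%:E ->
  g \in Lfun P 2%:E -> P.-integrable setT (EFin \o (fun x => f x * g x)).
Proof. by move=> lf lg; apply/Lfun1_integrable/Lfun2_mul_Lfun1. Qed.

Lemma Lfun2_integrable (f : T -> R) : f \in Lfun P 2%:E ->
  P.-integrable setT (EFin \o f).
Proof.
move=> lf; have := Lfun2_integrableM lf (Lfun_cst P 1 2).
by under eq_fun do rewrite mulr1.
Qed.

Lemma Lfun2P (f : T -> R) : measurable_fun setT f ->
  (\int[P]_x (f x ^+ 2)%:E < +oo)%E -> f \in Lfun P 2%:E.
Proof.
move=> mf f2; rewrite inE; apply/andP; split; rewrite inE//=.
rewrite /finite_norm unlock poweR_lty//.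
rewrite (eq_integral (fun x => (f x ^+ 2)%:E))// => x _ /=.
by rewrite powR_mulrn// real_normK// num_real.
Qed.

Lemma Lfun2_lincomb (I : finType) (A : pred I) (c : I -> R) (f : I -> T -> R) :
  (forall i, A i -> f i \in Lfun P 2%:E) ->
  (fun x => \sum_(i | A i) c i * f i x) \in Lfun P 2%:E.
Proof.
move=> lf.
have le12 : (1 <= 2%:E :> \bar R)%E by rewrite lee_fin ler1n.
have [L0 LD] := Lfun_submod_closed P le12.
have -> : (fun x => \sum_(i | A i) c i * f i x) = \sum_(i | A i) c i *: f i.
  by apply/funext => x; rewrite fct_sumE.
elim/big_ind: _ => [//|g h lg lh|i Ai].
  by have := LD 1 g h lg lh; rewrite scale1r.
by have := LD (c i) (f i) 0 (lf i Ai) L0; rewrite addr0.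
Qed.

Lemma Lfun2_sum (I : finType) (A : pred I) (f : I -> T -> R) :
  (forall i, A i -> f i \in Lfun P 2%:E) ->
  (fun x => \sum_(i | A i) f i x) \in Lfun P 2%:E.
Proof.
move=> lf; have := @Lfun2_lincomb I A (fun=> 1) f lf.
by under eq_fun do under eq_bigr do rewrite mul1r.
Qed.

End square_integrable.

(** * Alternating sums over subsets *)
Section signed_subset_sums.
Context (R : numDomainType) (I : finType).
Local Open Scope ring_scope.
Implicit Types (S T A : {set I}) (i : I).

Definition toggle i S : {set I} := if i \in S then S :\ i else i |: S.

Lemma in_toggle i S j : (j \in toggle i S) = (j == i) (+) (j \in S).
Proof.
rewrite /toggle; case: ifPn => iS; rewrite !inE;
  by have [->|] := eqVneq j i => //=; rewrite ?iS // (negPf iS).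
Qed.

Lemma toggleK i : involutive (toggle i).
Proof. by move=> S; apply/setP => j; rewrite !in_toggle addbA addbb. Qed.

(** A sign-reversing involution kills the sum. *)
Lemma sum_toggle_eq0 i (P : pred {set I}) (F : {set I} -> R) :
  (forall S, P (toggle i S) = P S) ->
  (forall S, P S -> F (toggle i S) = - F S) ->
  \sum_(S | P S) F S = 0.
Proof.
move=> tP tF; set s := LHS.
have : s = - s.
  rewrite {1}/s (reindex_inj (inv_inj (toggleK i))) -sumrN.
  by apply: eq_big => [S|S /=]; rewrite ?tP// => /tF.
move/eqP; rewrite -subr_eq0 opprK -mulr2n -mulr_natr mulf_eq0 pnatr_eq0 orbF.
by move/eqP.
Qed.

Definition parity (T S : {set I}) : R := (-1) ^+ #|T :\: S|.

Lemma parity_togglel i T S : i \notin S ->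
  parity (toggle i T) S = - parity T S.
Proof.
move=> iS; rewrite /parity.
have [iT|iT] := boolP (i \in T).
  rewrite (cardsD1 i (T :\: S)) finset.in_setD iS iT exprS mulN1r opprK.
  by congr (_ ^+ #|pred_of_set _|); apply/setP => j;
    rewrite !inE in_toggle; have [->|] := eqVneq j i; rewrite ?iT ?andbF.
rewrite (cardsD1 i (toggle i T :\: S)) finset.in_setD iS in_toggle eqxx (negPf iT)/=.
rewrite exprS mulN1r; congr (- _ ^+ #|pred_of_set _|); apply/setP => j.
by rewrite !inE in_toggle; have [->|] := eqVneq j i; rewrite ?(negPf iT) ?andbF.
Qed.

Lemma parity_toggler i T S : i \in T ->
  parity T (toggle i S) = - parity T S.
Proof.
move=> iT; rewrite /parity.
have [iS|iS] := boolP (i \in S).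
  rewrite (cardsD1 i (T :\: toggle i S)) finset.in_setD iT in_toggle eqxx iS/=.
  rewrite exprS mulN1r; congr (- _ ^+ #|pred_of_set _|); apply/setP => j.
  by rewrite !inE in_toggle; have [->|] := eqVneq j i; rewrite ?iS.
rewrite (cardsD1 i (T :\: S)) finset.in_setD iS iT exprS mulN1r opprK.
congr (_ ^+ #|pred_of_set _|); apply/setP => j.
by rewrite !inE in_toggle; have [->|] := eqVneq j i; rewrite ?(negPf iS).
Qed.

(** Moebius inversion on the lattice of subsets: for [S] properly included in
    [A], toggling an element of [A] outside [S] cancels the coefficient of
    [h S]. *)
Lemma moebius_set (h : {set I} -> R) A :
  \sum_(T : {set I} | T \subset A)
    \sum_(S : {set I} | S \subset T) parity T S * h S = h A.
Proof.
rewrite (exchange_big_dep (fun S : {set I} => S \subset A))/=; last first.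
  by move=> T S TA ST; exact: fintype.subset_trans ST TA.
rewrite (bigD1 A)//= [X in _ + X]big1 ?addr0.
  rewrite (big_pred1 A) => [|T]; last by rewrite /= finset.eqEsubset.
  by rewrite /parity finset.setDv cards0 expr0 mul1r.
move=> S /andP[SA nSA]; rewrite -big_distrl/=.
have : S \proper A by rewrite finset.properEneq nSA.
case/properP => _ [i iA iS].
rewrite (@sum_toggle_eq0 i) ?mul0r// => [T|T /andP[_ _]]; last first.
  exact: parity_togglel.
congr andb; apply/fintype.subsetP/fintype.subsetP => h' j; have := h' j;
  rewrite in_toggle; have [->|] := eqVneq j i => //=; by rewrite ?(negPf iS).
Qed.

(** Sets [T] not included in [A] contribute nothing: toggling in [S] an
    element of [T] outside [A] changes the sign but not [S :&: A]. The other
    sets have at most [D] elements and Moebius inversion applies. This is the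
    orthogonality of the Efron-Stein decomposition in numerical form. *)
Lemma sum_parity_setI (h : {set I} -> R) D A : (#|A| <= D)%N ->
  \sum_(T : {set I} | (#|T| <= D)%N)
    \sum_(S : {set I} | S \subset T) parity T S * h (S :&: A) = h A.
Proof.
move=> AD; rewrite (bigID (fun T : {set I} => T \subset A))/=.
rewrite [X in _ + X]big1 ?addr0 => [|T /andP[_ /fintype.subsetPn[i iT iA]]].
  rewrite -[RHS](moebius_set h A); apply: eq_big => [T|T /andP[_ TA]].
    rewrite andb_idl// => TA; exact: leq_trans (subset_leq_card TA) AD.
  apply: eq_bigr => S ST; congr (_ * h _).
  by apply/finset.setIidPl; exact: fintype.subset_trans ST TA.
apply: (@sum_toggle_eq0 i) => [S|S ST]; last first.
  rewrite parity_toggler// mulNr; congr (- (_ * h _)); apply/setP => j.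
  by rewrite !inE in_toggle; have [->|] := eqVneq j i; rewrite ?(negPf iA) ?andbF.
apply/fintype.subsetP/fintype.subsetP => h' j; have := h' j;
  rewrite in_toggle; have [->|] := eqVneq j i => //=; by rewrite ?iT.
Qed.

(** Inclusion-exclusion; a factor [0 + 1] outside [T] turns the product over
    [T] into one over the whole type, where distributivity applies. *)
Lemma prod_sub1 (u : I -> R) T :
  \prod_(i in T) (u i - 1) =
  \sum_(S : {set I} | S \subset T) parity T S * \prod_(i in S) u i.
Proof.
rewrite big_mkcond/=.
rewrite (eq_bigr (fun i => (if i \in T then u i else 0) +
    (if i \in T then -1 else 1))); last by move=> i _; case: ifP; rewrite ?add0r.
rewrite bigA_distr (bigID (fun S : {set I} => S \subset T))/=.
rewrite [X in _ + X]big1 ?addr0 => [|S /fintype.subsetPn[i iS iT]]; last first.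
  by rewrite (bigD1 i)//= iS (negPf iT) mul0r.
apply: eq_bigr => S ST; rewrite (bigID (mem S))/= mulrC; congr (_ * _).
  rewrite /parity -prodr_const [RHS]big_mkcond [LHS]big_mkcond.
  by apply: eq_bigr => i _; rewrite inE; case: (i \in S); case: (i \in T).
by apply: eq_bigr => i iS; rewrite iS (fintype.subsetP ST).
Qed.

End signed_subset_sums.

(** * Expanding the truncated exponential of a sum *)
Section exponential_expansion.
Context (R : realType).
Local Open Scope ring_scope.

(** Group the injective maps by their image: a set of [d] elements is the
    image of [d`!] of them, and the product only depends on the image. *)
Lemma sum_inj_prod n d (r : 'I_n -> R) :
  \sum_(f : {ffun 'I_d -> 'I_n} | injectiveb f) \prod_k r (f k) =
  (d`!)%:R * \sum_(T : {set 'I_n} | #|T| == d) \prod_(i in T) r i.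
Proof.
rewrite (partition_big (fun f : {ffun 'I_d -> 'I_n} => f @: 'I_d)
  (fun T => #|T| == d))/=; last first.
  by move=> f /injectiveP fi; rewrite card_imset// card_ord.
rewrite big_distrr/=; apply: eq_bigr => T /eqP Td.
transitivity (\sum_(f : {ffun 'I_d -> 'I_n} |
    injectiveb f && (f @: 'I_d == T)) \prod_(i in T) r i).
  apply: eq_bigr => f /andP[/injectiveP fi /eqP <-].
  rewrite big_imset/=; last by move=> i j _ _; exact: fi.
  by apply: eq_bigl => i; rewrite inE.
rewrite sumr_const mulr_natl; congr (_ *+ _).
have := card_inj_ffuns_on 'I_d (mem T); rewrite Td card_ord ffactnn => <-.
apply: eq_card => f; rewrite !inE unfold_in/= andbC.
apply/andP/andP => -[h1 fi]; split=> //.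
  apply/ffun_onP => k; rewrite -(eqP h1); exact: imset_f.
rewrite finset.eqEcard; apply/andP; split.
  by apply/fintype.subsetP => _ /imsetP[k _ ->]; exact: (ffun_onP h1).
by rewrite card_imset ?card_ord ?Td//; exact/injectiveP.
Qed.

(** The maps that hit some coordinate twice form the remainder. *)
Lemma exp_le_expand n D (r : 'I_n -> R) :
  exp_le D (\sum_(i < n) r i) =
  \sum_(T : {set 'I_n} | (#|T| <= D)%N) \prod_(i in T) r i +
  \sum_(d < D.+1) \sum_(f : {ffun 'I_d -> 'I_n} | ~~ injectiveb f)
     (d`!)%:R^-1 * \prod_k r (f k).
Proof.
rewrite (partition_big (fun T : {set 'I_n} => inord #|T| : 'I_D.+1) xpredT)//=.
rewrite -big_split/=; apply: eq_bigr => d _.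
have -> : (\sum_(i < n) r i) ^+ d = \prod_(k < d) \sum_(i < n) r i.
  by rewrite prodr_const card_ord.
rewrite bigA_distr_bigA/=.
rewrite [LHS]mulrC [LHS]big_distrr/=.
rewrite (bigID (fun f : {ffun 'I_d -> 'I_n} => injectiveb f))/=; congr (_ + _).
rewrite -big_distrr/= sum_inj_prod mulrA mulVf ?mul1r; last first.
  by rewrite pnatr_eq0 -lt0n fact_gt0.
apply: eq_bigl => T; apply/idP/idP => [/eqP Td|/andP[TD /eqP <-]].
  by rewrite Td -ltnS ltn_ord/= inord_val.
by rewrite inordK.
Qed.

End exponential_expansion.

(** * Positive semidefinite kernels *)
Section positive_definite.
Context (R : realType).
Local Open Scope ring_scope.

Definition psd (A : Type) (k : A -> A -> R) :=
  forall n (a : 'I_n -> A) (c : 'I_n -> R),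
    0 <= \sum_i \sum_j c i * c j * k (a i) (a j).

Lemma psd_scale (A : Type) (u : A -> R) (k : A -> A -> R) :
  psd k -> psd (fun a b => u a * u b * k a b).
Proof.
move=> pk n a c; have := pk n a (fun i => c i * u (a i)).
congr (_ <= _); apply: eq_bigr => i _; apply: eq_bigr => j _; ring.
Qed.

Lemma psd1 (A : Type) : psd (fun _ _ : A => 1).
Proof.
move=> n a c; under eq_bigr do under eq_bigr do rewrite mulr1.
by rewrite -big_distrlr/= -expr2 sqr_ge0.
Qed.

Definition gram d (T : measurableType d) (P : probability T R) (A : Type)
    (phi : A -> T -> R) (a b : A) : R :=
  \int[P]_x (phi a x * phi b x).

(** Schur's product theorem when one factor is a Gram kernel: for each point
    of the space where [phi] lives, the values of [phi] can be absorbed in the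
    coefficients [c], and positivity survives integration. *)
Lemma psdM_gram d (T : measurableType d) (P : probability T R) (A : Type)
    (phi : A -> T -> R) (k : A -> A -> R) :
  (forall a, phi a \in Lfun P 2%:E) -> psd k ->
  psd (fun a b => k a b * gram P phi a b).
Proof.
move=> lphi pk n a c.
have intphi i j := Lfun2_integrableM (lphi (a i)) (lphi (a j)).
rewrite pair_big/=.
under eq_bigr do rewrite mulrA.
have := @Rintegral_lincomb _ _ _ P ('I_n * 'I_n)%type xpredT
  (fun p => c p.1 * c p.2 * k (a p.1) (a p.2))
  (fun p x => phi (a p.1) x * phi (a p.2) x) (fun p _ => intphi p.1 p.2).
rewrite /gram => <-.
apply: Rintegral_ge0 => // x _.
have := pk n a (fun i => c i * phi (a i) x).
rewrite pair_big/=; congr (_ <= _); apply: eq_bigr => p _; ring.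
Qed.

Lemma psd_prod_gram d (T : measurableType d) (P : probability T R) (A B : Type)
    (phi : A -> T -> R) (n : nat) (h : 'I_n -> B -> A) :
  (forall a, phi a \in Lfun P 2%:E) ->
  psd (fun a b => \prod_(i < n) gram P phi (h i a) (h i b)).
Proof.
move=> lphi; elim: n h => [|n IH] h.
  under eq_fun do under eq_fun do rewrite big_ord0; exact: psd1.
under eq_fun do under eq_fun do rewrite big_ord_recr/=.
exact: (@psdM_gram _ _ P B (fun b => phi (h ord_max b)) _ (fun b => lphi _)
  (IH (fun i => h (widen_ord (leqnSn n) i)))).
Qed.

End positive_definite.

Section sampling.
Context d (T : measurableType d) (R : realType) (X : probability T R).

(** Distinct coordinates of an i.i.d. sample form a pair of independent
    draws. *)
Lemma pair_marginal n (i j : 'I_n) : i != j -> forall U, measurable U ->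
  (X \x X) U = pushforward (product_law (fun _ : 'I_n => X))
    (fun x => (tnth x i, tnth x j)) U.
Proof.
move=> ij.
have mp : measurable_fun setT (fun x : n.-tuple T => (tnth x i, tnth x j)).
  by apply: measurable_fun_pair; exact: measurable_tnth.
pose f : {mfun n.-tuple T >-> (T * T)%type} :=
  HB.pack (fun x : n.-tuple T => (tnth x i, tnth x j))
    (isMeasurableFun.Build _ _ _ _ _ mp).
apply: (@product_measure_unique _ _ _ _ _ X X
  (distribution (product_law (fun _ : 'I_n => X)) f)) => A B mA mB.
pose C k := if k == i then A else if k == j then B else setT.
have mC k : measurable (C k) by rewrite /C; case: ifP => // _; case: ifP.
transitivity (product_law (fun _ : 'I_n => X) (f @^-1` (A `*` B))); first by [].
rewrite (_ : f @^-1` _ = box C); last first.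
  apply/seteqP; split => x /=.
    by move=> [Ax Bx] k; rewrite /C; case: eqP => [->//|_]; case: eqP => [->|].
  move=> Cx; split; first by have := Cx i; rewrite /C eqxx.
  by have := Cx j; rewrite /C eq_sym (negPf ij) eqxx.
rewrite product_law_box// (bigD1 i)//= (bigD1 j)/=; last by rewrite eq_sym.
rewrite big1 => [|k /andP[ki kj]].
  by rewrite /C eqxx [j == i]eq_sym (negPf ij) eqxx mule1.
by rewrite /C (negPf ki) (negPf kj); exact: probability_setT.
Qed.

(** Average the kernel over all pairs taken from [n + 1] i.i.d. points: the
    [n + 1] diagonal pairs contribute at most [M] each and the [(n + 1) n]
    others have expectation [I], whence [0 <= M + n I] for all [n]. *)
Lemma psd_integral_ge0_bounded (k : T -> T -> R) (M : R) :
  psd k -> (forall a, k a a <= M)%R ->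
  (X \x X).-integrable setT (fun p => (k p.1 p.2)%:E) ->
  (0 <= \int[X \x X]_p k p.1 p.2)%R.
Proof.
move=> pk kM ik; set I := (leRHS).
have mk := measurable_int _ ik.
suff H n : (0 <= M + n%:R * I)%R.
  rewrite leNgt; apply/negP => I0.
  have M0 : (0 <= M)%R by have := H 0%N; rewrite mul0r addr0.
  have := H (Num.bound (M / - I)).
  rewrite leNgt => /negP; apply.
  have : (M / - I < (Num.bound (M / - I))%:R)%R.
    by apply: archi_boundP; rewrite divr_ge0// oppr_ge0 ltW.
  by rewrite ltr_pdivrMr ?oppr_gt0// mulrN; lra.
pose P := product_law (fun _ : 'I_n.+1 => X).
pose f (p : 'I_n.+1 * 'I_n.+1) (x : n.+1.-tuple T) := k (tnth x p.1) (tnth x p.2).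
have mp (p : 'I_n.+1 * 'I_n.+1) :
    measurable_fun setT (fun x : n.+1.-tuple T => (tnth x p.1, tnth x p.2)).
  by apply: measurable_fun_pair; exact: measurable_tnth.
have intf p : p.1 != p.2 -> P.-integrable setT (EFin \o f p).
  move=> pp; apply/integrableP; split.
    exact: (measurableT_comp mk (mp p)).
  have /integrableP[_] := ik; congr (_ < _).
  rewrite (eq_measure_integral (pushforward P
    (fun x => (tnth x p.1, tnth x p.2)))); last first.
    by move=> U mU _; exact: pair_marginal.
  rewrite ge0_integral_pushforward//.
  exact: measurableT_comp.
have If p : p.1 != p.2 -> (\int[P]_x f p x = I)%R.
  move=> pp; congr fine; symmetry.
  rewrite (eq_measure_integral (pushforward P
    (fun x => (tnth x p.1, tnth x p.2)))); last first.
    by move=> U mU _; exact: pair_marginal.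
  rewrite integral_pushforward//.
  by have := intf p pp; rewrite preimage_setT.
have : (0 <= \int[P]_x (n.+1%:R * M + \sum_(p | p.1 != p.2) 1 * f p x))%R.
  apply: Rintegral_ge0 => x _.
  have := pk _ (fun i => tnth x i) (fun=> 1%R).
  rewrite pair_big/= (bigID (fun p => p.1 != p.2))/= addrC => /le_trans; apply.
  apply: lerD; last by apply: ler_sum => p _; rewrite !mul1r.
  rewrite -(pair_big_dep xpredT (fun i j => ~~ (i != j))
    (fun i j => 1 * 1 * k (tnth x i) (tnth x j)))%R/=.
  rewrite -[X in X%:R](card_ord n.+1) mulr_natl -sumr_const; apply: ler_sum => i _.
  rewrite (big_pred1 i) => [|j]; last by rewrite /= negbK eq_sym.
  by rewrite !mul1r.
rewrite RintegralD//; last 2 first.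
- exact: finite_measure_integrable_cst.
- exact: integrable_lincomb.
rewrite Rintegral_lincomb// Rintegral_cst//.
rewrite (_ : fine _ = 1%R) ?mulr1; last first.
  exact: (congr1 fine (@probability_setT _ _ _ P)).
rewrite (eq_bigr (fun=> I)); last by move=> p pp; rewrite mul1r If.
rewrite -(pair_big_dep xpredT (fun i j : 'I_n.+1 => i != j) (fun i j => I))/=.
rewrite (eq_bigr (fun=> n%:R * I)%R) => [|i _]; last first.
  rewrite (eq_bigl (fun j => j \in predC1 i)) => [|j]; last by rewrite inE eq_sym.
  by rewrite sumr_const cardC1 card_ord/= mulr_natl.
by rewrite sumr_const card_ord -[(_ * I *+ _)%R]mulr_natl -mulrDr pmulr_rge0.
Qed.

(** The diagonal may have infinite expectation, so restrict the kernel to the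
    points where the diagonal is at most [m]. This keeps it positive
    semidefinite, and dominated convergence removes the restriction. *)
Lemma psd_integral_ge0 (k : T -> T -> R) :
  psd k -> (X \x X).-integrable setT (fun p => (k p.1 p.2)%:E) ->
  (0 <= \int[X \x X]_p k p.1 p.2)%R.
Proof.
move=> pk ik.
have mk := measurable_int _ ik.
pose B m : set T := [set a | k a a <= m%:R]%R.
have mB m : measurable (B m).
  have mkd : measurable_fun setT (fun a => k a a).
    apply/measurable_EFinP.
    apply: (measurableT_comp mk (g := fun a => (a, a))).
    exact: measurable_fun_pair.
  rewrite -[B m]setTI (_ : B m = (fun a => k a a) @^-1` `]-oo, m%:R]%classic).
    exact: mkd.
  by apply/seteqP; split => a /=; rewrite in_itv.
pose km m a b : R := (\1_(B m) a * \1_(B m) b * k a b)%R.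
have abs_km m a b : (`|km m a b| <= `|k a b|)%R.
  rewrite /km !normrM ler_piMl// mulr_ile1//;
  by rewrite indicE ger0_norm ?lern1 ?leq_b1.
have mkm m : measurable_fun setT (fun p : T * T => (km m p.1 p.2)%:E).
  apply/measurable_EFinP; apply: measurable_funM; last exact/measurable_EFinP.
  by apply: measurable_funM; apply: (measurableT_comp (measurable_indic (mB m))).
have km_cvg p : (fun m => (km m p.1 p.2)%:E) @ \oo --> (k p.1 p.2)%:E.
  apply: cvg_near_cst; near=> m.
  have h (a : T) : (k a a <= m%:R)%R -> \1_(B m) a = 1%R :> R.
    by move=> am; rewrite indicE mem_set.
  rewrite /km !h ?mul1r//; near: m; exact: nbhs_infty_ger.
have [ik' _ cvgI] := @dominated_convergence _ _ _ (X \x X) setT measurableT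
  (fun m p => (km m p.1 p.2)%:E) (fun p => (k p.1 p.2)%:E)
  (fun p => `|(k p.1 p.2)%:E|) mkm mk (aeW _ (fun p _ => km_cvg p))
  (integrable_abse ik) (aeW _ (fun p m _ => abs_km m p.1 p.2)).
rewrite fine_ge0//.
have km_ge0 m : 0 <= \int[X \x X]_p (km m p.1 p.2)%:E.
  have ikm : (X \x X).-integrable setT (fun p => (km m p.1 p.2)%:E).
    by apply: le_integrable ik => // p _; exact: abs_km.
  rewrite -(fineK (integrable_fin_num measurableT ikm)) lee_fin.
  apply: (@psd_integral_ge0_bounded (km m) m%:R) => //.
    exact: psd_scale.
  move=> a; rewrite /km indicE.
  have [aB|aB] := boolP (a \in B m); last by rewrite !mul0r.
  by rewrite !mul1r; exact: (set_mem aB).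
rewrite -(cvg_lim _ cvgI)//; apply: lime_ge.
  by apply/cvg_ex; eexists; exact: cvgI.
by near=> m; exact: km_ge0.
Unshelve. all: by end_near. Qed.

End sampling.

(** * The channel *)
Section real_integrals.
Context d (T : measurableType d) (R : realType).

Lemma expectation_Rintegral (P : probability T R) (f : T -> R) :
  P.-integrable setT (EFin \o f) -> 'E_P[f] = (\int[P]_x f x)%R%:E.
Proof.
by move=> fi; rewrite unlock /Rintegral fineK//; exact: integrable_fin_num.
Qed.

Lemma ae_eq_Lfun2 (P : probability T R) (f g : T -> R) :
  measurable_fun setT f -> ae_eq P setT (EFin \o f) (EFin \o g) ->
  g \in Lfun P 2%:E -> f \in Lfun P 2%:E.
Proof.
move=> mf fg lg; have mg := Lfun2_measurable lg.
apply: Lfun2P => //.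
rewrite (ae_eq_integral (fun y => (g y ^+ 2)%:E))//.
- exact/integrable_lty/Lfun2_integrable_sqr.
- exact/measurable_EFinP/measurable_funX.
- exact/measurable_EFinP/measurable_funX.
- by apply: filterS fg => y /= h /h [->].
Qed.

End real_integrals.

Section channel.
Context {R : realType} {Sigma : set R} {Sigma0 : Sigma 0%R}.
Context {d : measure_display} {Omega : measurableType d}.
Variable K : R.-pker (alphabet Sigma0) ~> Omega.
Local Notation P0 := (channel_law K (letter0 Sigma0)).

(** A choice, for each letter, of a nonnegative version of its likelihood
    ratio. *)
Definition ratio_version (p : alphabet Sigma0 -> Omega -> R) :=
  forall a, [/\ measurable_fun setT (p a), forall y, (0 <= p a y)%R,
    ae_eq P0 setT (EFin \o p a) (EFin \o likelihood_ratio K a) &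
    has_density (channel_law K a) P0 (EFin \o p a)].

Lemma ratio_version_ex :
  (forall a, channel_law K a `<< P0) -> exists p, ratio_version p.
Proof.
move=> dom; have hex a := has_densityP (dom a).
by have [p hp] := choice hex; exists p.
Qed.

Section overlap_facts.
Variable p : alphabet Sigma0 -> Omega -> R.
Hypothesis hp : ratio_version p.
Hypothesis ratio_L2 : forall a, likelihood_ratio K a \in Lfun P0 2%:E.

Lemma ratio_Lfun2 a : p a \in Lfun P0 2%:E.
Proof. by have [mp _ aep _] := hp a; exact: ae_eq_Lfun2 (ratio_L2 a). Qed.

Lemma centered_ratio_Lfun2 a : (fun y => p a y - 1)%R \in Lfun P0 2%:E.
Proof.
have lp := ratio_Lfun2 a.
have := @Lfun2_lincomb _ _ _ P0 bool xpredT
  (fun b => if b then 1 else -1)%R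
  (fun b => if b then p a else cst 1%R).
have -> : (fun x => \sum_(i : bool) (if i then 1 else -1) *
    (if i then p a else cst 1) x)%R = (fun y => p a y - 1)%R.
  by apply/funext => y; rewrite big_bool/= mul1r mulr1.
by apply => -[]// _; exact: Lfun_cst.
Qed.

Lemma overlapE a b : overlap K a b = gram P0 (fun a y => p a y - 1)%R a b.
Proof.
have [mp _ aea _] := hp a; have [mpb _ aeb _] := hp b.
rewrite /overlap unlock; congr fine; symmetry.
have ml c := Lfun2_measurable (ratio_L2 c).
apply: ae_eq_integral => //.
- by apply/measurable_EFinP/measurable_funM; apply: measurable_funB.
- by apply/measurable_EFinP/measurable_funM; apply: measurable_funB.
- by apply: filterS2 aea aeb => y /= ha hb _; move: (ha I) (hb I) => [->] [->].
Qed.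

(** Integrating a likelihood ratio against the law of another letter gives the
    uncentered overlap. This expresses overlaps through integrals of
    nonnegative functions, and bounds them below by [-1]. *)
Lemma integral_ratio a b :
  \int[channel_law K b]_y (p a y)%:E = (1 + overlap K a b)%:E.
Proof.
have [mp p0 aea dp] := hp a; have [mpb pb0 aeb dpb] := hp b.
rewrite dpb//=; last exact/measurable_EFinP.
have int1 c : (\int[P0]_y p c y = 1)%R.
  have [mc _ _ dc] := hp c.
  rewrite /Rintegral (_ : integral _ _ _ = 1)//.
  transitivity (\int[P0]_y (cst 1 y * (EFin \o p c) y)).
    by apply: eq_integral => y _; rewrite /= mul1e.
  by rewrite -dc//; exact: integral_cst_probability.
have intab := Lfun2_integrableM (ratio_Lfun2 a) (ratio_Lfun2 b).
have inta := Lfun2_integrable (ratio_Lfun2 a).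
have intb1 := Lfun2_integrable (centered_ratio_Lfun2 b).
have intb := Lfun2_integrable (ratio_Lfun2 b).
have int_1 : P0.-integrable setT (EFin \o cst (1:R)%R).
  exact: finite_measure_integrable_cst.
rewrite (_ : \int[P0]_y _ = (\int[P0]_y (p a y * p b y))%R%:E); last first.
  by rewrite /Rintegral fineK ?integrable_fin_num.
congr EFin; rewrite overlapE /gram.
have -> : (\int[P0]_y ((p a y - 1) * (p b y - 1)) =
  \int[P0]_y (p a y * p b y - (p a y + (p b y - 1))))%R.
  by apply: eq_Rintegral => y _; ring.
rewrite RintegralB//; last first.
  exact: (integrableD measurableT inta intb1).
rewrite RintegralD// RintegralB// !int1 Rintegral_cst//.
rewrite (_ : fine _ = 1%R); last exact: (congr1 fine (@probability_setT _ _ _ P0)).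
by ring.
Qed.

Lemma overlap_geN1 a b : (0 <= 1 + overlap K a b)%R.
Proof.
rewrite -lee_fin -integral_ratio; apply: integral_ge0 => y _.
by rewrite lee_fin; have [] := hp a.
Qed.

End overlap_facts.

End channel.

(** * The projection of the planted density *)
Section positive_parts.
Context d (T : measurableType d) (R : realType) (P : probability T R).
Local Open Scope ring_scope.

Lemma Lfun2_le (f g : T -> R) : measurable_fun setT f ->
  (forall y, `|f y| <= `|g y|) -> g \in Lfun P 2%:E -> f \in Lfun P 2%:E.
Proof.
move=> mf fg lg; have mg := Lfun2_measurable lg.
apply: Lfun2P => //.
apply: (@le_lt_trans _ _ (\int[P]_y (g y ^+ 2)%:E)%E); last first.
  exact/integrable_lty/Lfun2_integrable_sqr.
apply: ge0_le_integral => //.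
- by move=> y _; rewrite lee_fin sqr_ge0.
- by apply/measurable_EFinP; apply: measurable_funX.
- by apply/measurable_EFinP; apply: measurable_funX.
- move=> y _; rewrite lee_fin -[f y ^+ 2]real_normK ?num_real//.
  by rewrite -[g y ^+ 2]real_normK ?num_real// lerXn2r// nnegrE.
Qed.

Lemma funrpos_Lfun2 (g : T -> R) : g \in Lfun P 2%:E -> g^\+ \in Lfun P 2%:E.
Proof.
move=> lg; apply: (Lfun2_le _ _ lg).
  by apply: measurable_maxr => //; exact: Lfun2_measurable lg.
move=> y; rewrite ger0_norm ?funrpos_ge0// ge_max normr_ge0 andbT.
exact: ler_norm.
Qed.

Lemma Lfun2N (g : T -> R) : g \in Lfun P 2%:E -> (\- g) \in Lfun P 2%:E.
Proof.
move=> lg; apply: (Lfun2_le _ _ lg); last by move=> y /=; rewrite normrN.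
by apply: measurableT_comp => //; exact: Lfun2_measurable lg.
Qed.

End positive_parts.

Section low_degree_projection.
Context {R : realType} {Sigma : set R} {Sigma0 : Sigma 0%R}.
Context {d : measure_display} {Omega : measurableType d}.
Variables (K : R.-pker (alphabet Sigma0) ~> Omega) (N : nat).
Variable X : probability (N.-tuple (alphabet Sigma0)) R.
Local Notation Q := (null_law K N).
Local Notation PL := (planted_law K X).
Implicit Types (S T A : {set 'I_N}) (x : N.-tuple (alphabet Sigma0)).

Definition null_channel (i : 'I_N) : probability Omega R :=
  channel_law K (letter0 Sigma0).

(** The law of the observation when the letters of [x] outside [S] are
    replaced by 0. *)
Definition masked_law x S : probability (N.-tuple Omega) R :=
  product_law (splice_law S (fun i => channel_law K (tnth x i)) null_channel).

Local Notation avgQ := (avg null_channel).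

Lemma integral_planted h : measurable_fun setT h -> (forall y, 0 <= h y) ->
  \int[PL]_y h y = \int[X]_x \int[observation_law K x]_y h y.
Proof. exact: integral_mixture. Qed.

Lemma integral_planted_avg S h : measurable_fun setT h ->
  (forall y, 0 <= h y) ->
  \int[PL]_y avgQ S h y = \int[X]_x \int[masked_law x S]_y h y.
Proof.
move=> mh h0; rewrite integral_planted; last 2 first.
- exact: measurable_avg.
- exact: avg_ge0.
by apply: eq_integral => x _; exact: integral_avg.
Qed.

Lemma splice_lawI S A (mu nu : 'I_N -> probability Omega R) :
  splice_law A (splice_law S mu nu) nu = splice_law (S :&: A) mu nu.
Proof.
apply/funext => i; rewrite /splice_law inE.
by case: (i \in A); rewrite ?andbT ?andbF.
Qed.

(** If [h] depends only on the coordinates in [A], it is its own average over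
    the others, and masking outside [S] and then outside [A] is masking
    outside [S :&: A]. *)
Lemma integral_planted_avg_setI S A h : measurable_fun setT h ->
  (forall y, 0 <= h y) -> depends_only_on A h ->
  \int[PL]_y avgQ S h y = \int[PL]_y avgQ (S :&: A)%SET h y.
Proof.
move=> mh h0 hA; rewrite !integral_planted_avg//; apply: eq_integral => x _.
by rewrite -{1}(avg_id null_channel hA) /masked_law integral_avg// splice_lawI.
Qed.

Variable L : N.-tuple Omega -> R.
Hypotheses (mL : measurable_fun setT L) (L0 : forall y, (0 <= L y)%R).
Hypotheses (dL : has_density PL Q (EFin \o L)) (LL2 : L \in Lfun Q 2%:E).

Let mLE : measurable_fun setT (EFin \o L). Proof. exact/measurable_EFinP. Qed.
Let LE0 y : 0 <= (EFin \o L) y. Proof. by rewrite lee_fin. Qed.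

(** The density of the law of the planted coordinates in [S]. *)
Definition marginal S (y : N.-tuple Omega) : R := fine (avgQ S (EFin \o L) y).

Lemma integral_avgQ S h : measurable_fun setT h -> (forall y, 0 <= h y) ->
  \int[Q]_y avgQ S h y = \int[Q]_y h y.
Proof. by move=> mh h0; rewrite integral_avg// splice_lawid. Qed.

Lemma marginal_ge0 S y : (0 <= marginal S y)%R.
Proof. by apply: fine_ge0; exact: avg_ge0. Qed.

Lemma measurable_marginal S : measurable_fun setT (marginal S).
Proof.
apply: (measurableT_comp (fine_measurable measurableT)).
exact: measurable_avg.
Qed.

Lemma marginal_depends_only_on S : depends_only_on S (marginal S).
Proof. by move=> y z yz; rewrite /marginal (avg_depends_only_on _ _ yz). Qed.

(** [L] is integrable, hence so is its average, which is finite almost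
    everywhere. *)
Lemma marginal_ae S :
  ae_eq Q setT (EFin \o marginal S) (avgQ S (EFin \o L)).
Proof.
have : Q.-integrable setT (avgQ S (EFin \o L)).
  apply/integrableP; split; first exact: measurable_avg.
  under eq_integral do rewrite gee0_abs ?avg_ge0//.
  rewrite integral_avgQ//; apply: integrable_lty => //.
  exact: Lfun2_integrable.
move/(integrable_ae measurableT).
by apply: filterS => y /= yfin _; rewrite /marginal fineK// yfin.
Qed.

(** Self-adjointness moves the average from [L] to the test function, and [L]
    then turns the null law into the planted law. *)
Lemma integral_marginalM S h : measurable_fun setT h -> (forall y, 0 <= h y) ->
  \int[Q]_y ((marginal S y)%:E * h y) = \int[PL]_y avgQ S h y.
Proof.
move=> mh h0; rewrite dL; [|exact: measurable_avg|exact: avg_ge0].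
transitivity (\int[Q]_y (avgQ S (EFin \o L) y * h y)).
  apply: ae_eq_integral => //.
  - apply: emeasurable_funM => //.
    by apply/measurable_EFinP; exact: measurable_marginal.
  - by apply: emeasurable_funM => //; exact: measurable_avg.
  - by apply: filterS (marginal_ae S) => y /= h' /h' ->.
rewrite [LHS]avg_selfadjoint//.
by apply: eq_integral => y _; rewrite muleC.
Qed.

(** Averaging contracts the norm of [L^2], by the Cauchy-Schwarz inequality in
    the averaged coordinates. *)
Lemma marginal_Lfun2 S : marginal S \in Lfun Q 2%:E.
Proof.
apply: Lfun2P; first exact: measurable_marginal.
have mL2 : measurable_fun setT (fun y => (L y ^+ 2)%:E).
  exact/measurable_EFinP/measurable_funX.
have L20 y : 0 <= (L y ^+ 2)%:E by rewrite lee_fin sqr_ge0.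
apply: (@le_lt_trans _ _ (\int[Q]_y (L y ^+ 2)%:E)); last first.
  exact/integrable_lty/Lfun2_integrable_sqr.
rewrite -(integral_avgQ S)//; apply: ge0_le_integral => //.
- by move=> y _; rewrite lee_fin sqr_ge0.
- by apply/measurable_EFinP; apply: measurable_funX; exact: measurable_marginal.
- exact: measurable_avg.
move=> y _.
have mLy : measurable_fun setT (fun z => L (splice S y z)).
  apply: (measurableT_comp mL (g := fun z => splice S y z)).
  exact: (measurableT_comp (measurable_splice S) (measurable_pair1 y)).
apply: le_trans (sqr_integral_le Q mLy _) => //.
rewrite /marginal; set I := avgQ S (EFin \o L) y.
have : 0 <= I by exact: avg_ge0.
change (0 <= I -> (fine I ^+ 2)%:E <= I * I).
case: I => [r|_|//] /=; first by rewrite -EFinM expr2.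
by rewrite mulyy expr0n/= leey.
Qed.

(** Under the planted law the integral of [f] is the inner product of [f] with
    [L], finite as both are square integrable. *)
Lemma planted_integrable (f : N.-tuple Omega -> R) : f \in Lfun Q 2%:E ->
  PL.-integrable setT (EFin \o f).
Proof.
move=> lf; have mf := Lfun2_measurable lf; apply/integrableP; split.
  exact/measurable_EFinP.
have mfE : measurable_fun setT (EFin \o f) by exact/measurable_EFinP.
rewrite dL//; last exact: measurableT_comp.
have /integrableP[_] := Lfun2_integrableM lf LL2; apply: le_lt_trans.
rewrite le_eqVlt; apply/orP; left; apply/eqP.
by apply: eq_integral => y _ /=; rewrite normrM EFinM (ger0_norm (L0 y)).
Qed.


Lemma marginal_test_ge0 S (g : N.-tuple Omega -> R) :
  measurable_fun setT g -> (forall y, (0 <= g y)%R) ->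
  (\int[Q]_y (marginal S y * g y))%R = fine (\int[PL]_y avgQ S (EFin \o g) y).
Proof.
move=> mg g0; congr fine; rewrite -integral_marginalM//.
exact/measurable_EFinP.
Qed.

(** Identities proved with Tonelli's theorem hold for nonnegative test
    functions; this extends them to signed ones. *)
Lemma split_test (P : probability (N.-tuple Omega) R)
    (w g : N.-tuple Omega -> R) :
  (forall h, h \in Lfun Q 2%:E ->
    P.-integrable setT (EFin \o (fun y => w y * h y)%R)) ->
  g \in Lfun Q 2%:E ->
  (\int[P]_y (w y * g y) = \int[P]_y (w y * g^\+ y) -
    \int[P]_y (w y * ((\- g)^\+)%R y))%R.
Proof.
move=> iw lg; rewrite -RintegralB//; last 2 first.
- by apply: iw; exact: funrpos_Lfun2.
- by apply: iw; apply: funrpos_Lfun2; exact: Lfun2N.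
apply: eq_Rintegral => y _; rewrite funrposN -mulrBr.
by rewrite -[X in (_ * X = _)%R](congr1 (@^~ y) (funrposBneg g)).
Qed.

Lemma depends_only_on_funrpos A (g : N.-tuple Omega -> R) :
  depends_only_on A g -> depends_only_on A (EFin \o (g^\+)%R).
Proof. by move=> gA y z yz; rewrite /= /funrpos (gA y z yz). Qed.

(** The analogue for signed functions of [integral_planted_avg_setI]. *)
Lemma marginal_test_setI S A (g : N.-tuple Omega -> R) :
  g \in Lfun Q 2%:E -> depends_only_on A g ->
  (\int[Q]_y (marginal S y * g y) =
   \int[Q]_y (marginal (S :&: A)%SET y * g y))%R.
Proof.
move=> lg gA.
have iM U h : h \in Lfun Q 2%:E ->
    Q.-integrable setT (EFin \o (fun y => marginal U y * h y)%R).
  by apply: Lfun2_integrableM; exact: marginal_Lfun2.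
rewrite (split_test (iM S) lg) (split_test (iM _) lg).
have gNA : depends_only_on A (\- g)%R.
  by move=> y z yz; rewrite /= (gA y z yz).
have mp h : h \in Lfun Q 2%:E -> measurable_fun setT (h^\+)%R.
  by move=> lh; apply: (Lfun2_measurable (P := Q)); exact: funrpos_Lfun2.
have lN := Lfun2N lg.
have E h : h \in Lfun Q 2%:E -> depends_only_on A h ->
    (\int[Q]_y (marginal S y * h^\+ y) =
     \int[Q]_y (marginal (S :&: A)%SET y * h^\+ y))%R.
  move=> lh hA; have h0 := funrpos_ge0 h.
  have mh := mp h lh; rewrite [LHS](marginal_test_ge0 S mh h0).
  rewrite [RHS](marginal_test_ge0 _ mh h0); congr fine.
  apply: integral_planted_avg_setI.
  - by apply/measurable_EFinP; exact: mp.
  - by move=> y; rewrite lee_fin.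
  - exact: depends_only_on_funrpos.
by rewrite !E.
Qed.

Lemma marginal_test A (g : N.-tuple Omega -> R) :
  g \in Lfun Q 2%:E -> depends_only_on A g ->
  (\int[Q]_y (marginal A y * g y) = \int[PL]_y g y)%R.
Proof.
move=> lg gA.
have iM h : h \in Lfun Q 2%:E ->
    Q.-integrable setT (EFin \o (fun y => marginal A y * h y)%R).
  by apply: Lfun2_integrableM; exact: marginal_Lfun2.
rewrite (split_test iM lg).
have := @split_test PL (cst 1%R) g _ lg.
under eq_Rintegral do rewrite mul1r.
move=> ->; last first.
  move=> h /planted_integrable; congr (_.-integrable _ _).
  by apply/funext => y /=; rewrite mul1r.
have mp h : h \in Lfun Q 2%:E -> measurable_fun setT (h^\+)%R.
  by move=> lh; apply: (Lfun2_measurable (P := Q)); exact: funrpos_Lfun2.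
have lN := Lfun2N lg.
have gNA : depends_only_on A (\- g)%R.
  by move=> y z yz; rewrite /= (gA y z yz).
have E h : h \in Lfun Q 2%:E -> depends_only_on A h ->
    (\int[Q]_y (marginal A y * h^\+ y) =
     \int[PL]_y (cst 1 y * h^\+ y))%R.
  move=> lh hA; have h0 := funrpos_ge0 h.
  rewrite marginal_test_ge0//; last exact: mp.
  rewrite avg_id; last exact: depends_only_on_funrpos.
  by congr fine; apply: eq_integral => y _; rewrite /= mul1r.
by rewrite !E.
Qed.


Let marginal_L2 S : marginal S \in Lfun Q 2%:E.
Proof. exact: marginal_Lfun2. Qed.

Lemma marginal_coordinate_space S T : S \subset T ->
  coordinate_space K T (marginal S).
Proof.
move=> ST; split=> // y z yz; apply: marginal_depends_only_on => i iS.
exact/yz/(fintype.subsetP ST).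
Qed.

(** The Efron-Stein component of [L] on the coordinates in [T]. *)
Definition component T (y : N.-tuple Omega) : R :=
  (\sum_(S : {set 'I_N} | S \subset T) parity R T S * marginal S y)%R.

(** The orthogonal projection of [L] on the functions of degree at most [D],
    which is what [low_degree_part_space] and [low_degree_part_test] say
    together. *)
Definition low_degree_part D (y : N.-tuple Omega) : R :=
  (\sum_(T : {set 'I_N} | (#|T| <= D)%N) component T y)%R.

Lemma component_coordinate_space T : coordinate_space K T (component T).
Proof.
split; first by apply: Lfun2_lincomb.
move=> y z yz; apply: eq_bigr => S ST; congr (_ * _)%R.
by have [_] := marginal_coordinate_space ST; apply.
Qed.

Lemma low_degree_part_space D : degree_space K D (low_degree_part D).
Proof. by exists component => // T _; exact: component_coordinate_space. Qed.

Lemma degree_space_Lfun2 D f : degree_space K D f -> f \in Lfun Q 2%:E.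
Proof.
by move=> [g gT ->]; apply: Lfun2_sum => T /gT[].
Qed.

Let integrable_marginalM S g : g \in Lfun Q 2%:E ->
  Q.-integrable setT (EFin \o (fun y => marginal S y * g y)%R).
Proof. exact: Lfun2_integrableM. Qed.

Lemma integral_componentM T g : g \in Lfun Q 2%:E ->
  (\int[Q]_y (component T y * g y) =
   \sum_(S : {set 'I_N} | S \subset T)
     parity R T S * \int[Q]_y (marginal S y * g y))%R.
Proof.
move=> lg; rewrite -Rintegral_lincomb; last first.
  by move=> S _; exact: integrable_marginalM.
apply: eq_Rintegral => y _; rewrite big_distrl/=.
by apply: eq_bigr => S _; rewrite mulrA.
Qed.

Lemma integral_low_degree_partM D g : g \in Lfun Q 2%:E ->
  (\int[Q]_y (low_degree_part D y * g y) =
   \sum_(T : {set 'I_N} | (#|T| <= D)%N) \int[Q]_y (component T y * g y))%R.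
Proof.
move=> lg; rewrite -Rintegral_sum => [|T _].
  by apply: eq_Rintegral => y _; rewrite /low_degree_part big_distrl.
by apply: Lfun2_integrableM => //; have [] := component_coordinate_space T.
Qed.

(** Expanding the components leaves an alternating sum of inner products that
    depend on [S :&: A] only. *)
Lemma low_degree_part_test_coordinate D A g : (#|A| <= D)%N ->
  coordinate_space K A g ->
  (\int[Q]_y (low_degree_part D y * g y) = \int[PL]_y g y)%R.
Proof.
move=> AD [lg gA]; rewrite integral_low_degree_partM//.
rewrite -(marginal_test lg gA).
rewrite -[RHS](sum_parity_setI
  (fun S => \int[Q]_y (marginal S y * g y))%R AD).
apply: eq_bigr => T _; rewrite (integral_componentM T lg).
by apply: eq_bigr => S _; rewrite (marginal_test_setI S lg gA).
Qed.

Lemma low_degree_part_test D f : degree_space K D f ->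
  (\int[Q]_y (low_degree_part D y * f y) = \int[PL]_y f y)%R.
Proof.
move=> [g gT ->].
have lg T : (#|T| <= D)%N -> g T \in Lfun Q 2%:E by move=> /gT[].
rewrite [RHS]Rintegral_sum => [|T /lg lgT]; last first.
  exact: (planted_integrable lgT).
under eq_Rintegral do rewrite big_distrr/=.
rewrite Rintegral_sum => [|T TD]; last first.
  apply: Lfun2_integrableM; last exact: lg.
  exact: degree_space_Lfun2 (low_degree_part_space D).
apply: eq_bigr => T TD.
exact: (low_degree_part_test_coordinate TD (gT T TD)).
Qed.


Local Notation P0 := (channel_law K (letter0 Sigma0)).

Variable p : alphabet Sigma0 -> Omega -> R.
Hypothesis hp : ratio_version K p.
Hypothesis ratio_L2 : forall a, likelihood_ratio K a \in Lfun P0 2%:E.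
Hypothesis moverlap : measurable_fun [set: alphabet Sigma0 * alphabet Sigma0]
  (fun ab => overlap K ab.1 ab.2).

(** The factors of the density of [masked_law x S]. *)
Definition masked_ratio x S (i : 'I_N) (a : Omega) : \bar R :=
  if i \in S then (p (tnth x i) a)%:E else 1.

Lemma masked_ratio_ge0 x S i a : 0 <= masked_ratio x S i a.
Proof.
by rewrite /masked_ratio; case: ifP => // _; rewrite lee_fin; have [] := hp (tnth x i).
Qed.

Lemma measurable_masked_ratio x S i : measurable_fun setT (masked_ratio x S i).
Proof.
rewrite /masked_ratio; case: (i \in S); last exact: measurable_cst.
by apply/measurable_EFinP; have [] := hp (tnth x i).
Qed.

Lemma masked_law_density x S : has_density (masked_law x S) Q
  (fun y => \prod_(i < N) masked_ratio x S i (tnth y i)).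
Proof.
apply: (@product_law_density _ _ _ _ null_channel).
- exact: measurable_masked_ratio.
- exact: masked_ratio_ge0.
- move=> i; rewrite /splice_law /masked_ratio; case: (i \in S).
    by have [] := hp (tnth x i).
  by move=> h mh h0; apply: eq_integral => y _; rewrite mule1.
Qed.

Definition shifted_overlap S
    (x : N.-tuple (alphabet Sigma0) * N.-tuple (alphabet Sigma0)) : R :=
  (\prod_(i in S) (1 + overlap K (tnth x.1 i) (tnth x.2 i)))%R.

Lemma measurable_tuple_overlap i : measurable_fun setT
  (fun x : N.-tuple (alphabet Sigma0) * N.-tuple (alphabet Sigma0) =>
     overlap K (tnth x.1 i) (tnth x.2 i)).
Proof.
have mg : measurable_fun setT
    (fun x : N.-tuple (alphabet Sigma0) * N.-tuple (alphabet Sigma0) =>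
       (tnth x.1 i, tnth x.2 i)).
  apply: measurable_fun_pair.
    exact: (measurableT_comp (measurable_tnth i) measurable_fst).
  exact: (measurableT_comp (measurable_tnth i) measurable_snd).
exact: (measurableT_comp moverlap mg).
Qed.

Lemma measurable_shifted_overlap S : measurable_fun setT (shifted_overlap S).
Proof.
rewrite /shifted_overlap; under eq_fun do rewrite -big_enum.
apply: measurable_prod => i iS; apply: measurable_funD => //.
exact: measurable_tuple_overlap.
Qed.

Lemma shifted_overlap_ge0 S q : (0 <= shifted_overlap S q)%R.
Proof. by apply: prodr_ge0 => i _; exact: (overlap_geN1 hp ratio_L2). Qed.

Lemma integral_masked_ratio x x' S :
  \int[observation_law K x']_y \prod_(i < N) masked_ratio x S i (tnth y i) =
  (shifted_overlap S (x, x'))%:E.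
Proof.
rewrite integral_product_law_prod; last 2 first.
- exact: measurable_masked_ratio.
- exact: masked_ratio_ge0.
rewrite /shifted_overlap -prodEFin [RHS]big_mkcond/=.
apply: eq_bigr => i _; rewrite /masked_ratio; case: (i \in S).
  exact: (integral_ratio hp ratio_L2).
exact: integral_cst_probability.
Qed.

(** The inner product of [L] with itself averaged outside [S] becomes an
    expectation over the first replica [x] under [masked_law x S]; exchanging
    that law for its density puts [L] back in front of a function of the
    observation, and [L] then produces the second replica. *)
Lemma planted_marginal S : \int[PL]_y (marginal S y)%:E =
  \int[X \x X]_q (shifted_overlap S q)%:E.
Proof.
have mm : measurable_fun setT (fun y => (marginal S y)%:E).
  by apply/measurable_EFinP; exact: measurable_marginal.
rewrite dL//; last by move=> y; rewrite lee_fin; exact: marginal_ge0.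
rewrite integral_marginalM// integral_planted_avg//.
rewrite fubini_tonelli1/=; last 2 first.
- by apply/measurable_EFinP; exact: measurable_shifted_overlap.
- by move=> x; rewrite lee_fin; exact: shifted_overlap_ge0.
apply: eq_integral => x _; rewrite masked_law_density//.
have mr : measurable_fun setT (fun y : N.-tuple Omega =>
    \prod_(i < N) masked_ratio x S i (tnth y i)).
  apply: measurable_prod_tnth => i; exact: measurable_masked_ratio.
have r0 (y : N.-tuple Omega) : 0 <= \prod_(i < N) masked_ratio x S i (tnth y i).
  by apply: prode_ge0 => i _; exact: masked_ratio_ge0.
transitivity (\int[PL]_y \prod_(i < N) masked_ratio x S i (tnth y i)).
  by rewrite dL//; apply: eq_integral => y _; rewrite muleC.
rewrite integral_planted//; apply: eq_integral => x' _.
exact: integral_masked_ratio.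
Qed.

Lemma integrable_shifted_overlap S :
  (X \x X).-integrable setT (EFin \o shifted_overlap S).
Proof.
apply/integrableP; split.
  by apply/measurable_EFinP; exact: measurable_shifted_overlap.
under eq_integral => q _.
  rewrite [`|_|](_ : _ = (shifted_overlap S q)%:E); last first.
    by rewrite gee0_abs// lee_fin shifted_overlap_ge0.
  over.
rewrite -planted_marginal; apply: integrable_lty => //.
apply: planted_integrable; exact: marginal_Lfun2.
Qed.

Lemma prod_overlapE T
    (q : N.-tuple (alphabet Sigma0) * N.-tuple (alphabet Sigma0)) :
  (\prod_(i in T) overlap K (tnth q.1 i) (tnth q.2 i) =
  \sum_(S : {set 'I_N} | S \subset T) parity R T S * shifted_overlap S q)%R.
Proof.
rewrite /shifted_overlap -prod_sub1; apply: eq_bigr => i _.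
by rewrite addrC addKr.
Qed.

Lemma integrable_prod_overlap T : (X \x X).-integrable setT
  (EFin \o (fun q => \prod_(i in T) overlap K (tnth q.1 i) (tnth q.2 i))%R).
Proof.
rewrite (_ : (fun q => _) = (fun q => \sum_(S : {set 'I_N} | S \subset T)
    parity R T S * shifted_overlap S q)%R); last first.
  by apply/funext => q; exact: prod_overlapE.
by apply: integrable_lincomb => S _; exact: integrable_shifted_overlap.
Qed.

Lemma integral_prod_overlap T :
  (\int[X \x X]_q (\prod_(i in T) overlap K (tnth q.1 i) (tnth q.2 i)) =
   \int[PL]_y component T y)%R.
Proof.
under eq_Rintegral do rewrite prod_overlapE.
rewrite Rintegral_lincomb => [|S _]; last exact: integrable_shifted_overlap.
rewrite Rintegral_lincomb => [|S _]; last first.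
  by apply: planted_integrable; exact: marginal_Lfun2.
apply: eq_bigr => S _; congr (_ * _)%R.
by rewrite /Rintegral planted_marginal.
Qed.

Definition low_degree_overlap D
    (q : N.-tuple (alphabet Sigma0) * N.-tuple (alphabet Sigma0)) : R :=
  (\sum_(T : {set 'I_N} | (#|T| <= D)%N)
     \prod_(i in T) overlap K (tnth q.1 i) (tnth q.2 i))%R.

Lemma integrable_low_degree_overlap D :
  (X \x X).-integrable setT (EFin \o low_degree_overlap D).
Proof.
have -> : EFin \o low_degree_overlap D = (fun q =>
    \sum_(T : {set 'I_N} | (#|T| <= D)%N)
      (\prod_(i in T) overlap K (tnth q.1 i) (tnth q.2 i))%R%:E).
  by apply/funext => q; rewrite sumEFin.
by apply: integrable_sum => // T _; exact: integrable_prod_overlap.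
Qed.

(** The squared norm of the projection is its expectation under the planted
    law. *)
Lemma integral_low_degree_overlap D :
  (\int[X \x X]_q low_degree_overlap D q =
   \int[Q]_y (low_degree_part D y * low_degree_part D y))%R.
Proof.
rewrite low_degree_part_test; last first.
  exact: low_degree_part_space.
rewrite Rintegral_sum => [|T _]; last exact: integrable_prod_overlap.
rewrite Rintegral_sum => [|T _]; last first.
  apply: planted_integrable.
  by have [] := component_coordinate_space T.
by apply: eq_bigr => T _; exact: integral_prod_overlap.
Qed.

Lemma degree_space_scale D (f : N.-tuple Omega -> R) (c : R) :
  degree_space K D f -> degree_space K D (fun y => c * f y)%R.
Proof.
move=> [g gT ->]; exists (fun T y => c * g T y)%R => [T /gT[lg gT']|].
  split; last by move=> y z yz; rewrite (gT' y z yz).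
  have := @Lfun2_lincomb _ _ _ Q unit xpredT (fun=> c) (fun=> g T) (fun _ _ => lg).
  by under eq_fun do rewrite big_const card_unit/= addr0.
by apply/funext => y; rewrite big_distrr.
Qed.

Section attained.
Variable D : nat.
Local Notation F := (low_degree_part D).
Let v : R := (\int[Q]_y (F y * F y))%R.

Let spaceF : degree_space K D F.
Proof. exact: low_degree_part_space. Qed.

Let LF : F \in Lfun Q 2%:E. Proof. exact: degree_space_Lfun2 spaceF. Qed.

Let int1 (P : probability (N.-tuple Omega) R) :
  P.-integrable setT (EFin \o cst (1%R : R)).
Proof. exact: finite_measure_integrable_cst. Qed.

Let Rint1 (P : probability (N.-tuple Omega) R) : (\int[P]_y (1:R) = 1)%R.
Proof. exact: (congr1 fine (integral_cst_probability P 1)). Qed.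

Let LF2 c f : degree_space K D f ->
  Q.-integrable setT (EFin \o (fun y => c * (F y * f y))%R).
Proof.
move=> Df; apply: (integrableZl measurableT c (f := EFin \o (fun y => F y * f y)%R)).
by apply: Lfun2_integrableM => //; exact: degree_space_Lfun2 Df.
Qed.

(** The projection has the same inner product with the constant 1 as [L],
    namely 1. So its norm is positive and it can be normalised. *)
Lemma low_degree_norm_ge1 : (1 <= v)%R.
Proof.
have F1 : (\int[Q]_y F y = 1)%R.
  have := @low_degree_part_test_coordinate D finset.set0 (cst 1%R).
  rewrite cards0 => /(_ isT); rewrite /= Rint1.
  under eq_Rintegral do rewrite mulr1.
  by apply; split => //; exact: Lfun_cst.
have : (0 <= \int[Q]_y (F y - 1) ^+ 2)%R.
  by apply: Rintegral_ge0 => y _; exact: sqr_ge0.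
have -> : (\int[Q]_y (F y - 1) ^+ 2 = \int[Q]_y (F y * F y - (2 * F y - 1)))%R.
  by apply: eq_Rintegral => y _; ring.
have i2F : Q.-integrable setT (EFin \o (fun y => 2 * F y)%R).
  exact: (integrableZl measurableT 2%R (Lfun2_integrable LF)).
rewrite RintegralB//; last 2 first.
- exact: Lfun2_integrableM.
- exact: (integrableB measurableT i2F (int1 Q)).
rewrite RintegralB//; last exact: int1.
rewrite RintegralZl//; last exact: Lfun2_integrable.
by rewrite F1 Rint1 -/v; lra.
Qed.

(** Cauchy-Schwarz, in the form [0 <= |F - c f| ^+ 2] with [c] the norm of
    [F]. *)
Lemma test_functions_le f : test_functions K D f ->
  (\int[PL]_y f y <= Num.sqrt v)%R.
Proof.
move=> [Df f2]; have lf := degree_space_Lfun2 Df.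
have v0 : (0 < v)%R by exact: lt_le_trans low_degree_norm_ge1.
set c := Num.sqrt v; have c0 : (0 < c)%R by rewrite sqrtr_gt0.
have cc : (c * c = v)%R by rewrite -expr2 sqr_sqrtr// ltW.
have {}f2 : (\int[Q]_y (f y * f y) <= 1)%R.
  move: f2; rewrite unlock => f2.
  rewrite -lee_fin /Rintegral fineK; last first.
    exact/integrable_fin_num/Lfun2_integrableM.
  by apply: le_trans f2; under eq_integral do rewrite -expr2.
rewrite -(low_degree_part_test Df).
have : (0 <= \int[Q]_y (F y - c * f y) ^+ 2)%R.
  by apply: Rintegral_ge0 => y _; exact: sqr_ge0.
have -> : (\int[Q]_y (F y - c * f y) ^+ 2 =
    \int[Q]_y (F y * F y - ((2 * c) * (F y * f y) - (c * c) * (f y * f y))))%R.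
  by apply: eq_Rintegral => y _; ring.
have iff : Q.-integrable setT (EFin \o (fun y => f y * f y)%R).
  exact: Lfun2_integrableM.
have iccff : Q.-integrable setT (EFin \o (fun y => c * c * (f y * f y))%R).
  exact: (integrableZl measurableT (c * c)%R iff).
rewrite RintegralB//; last 2 first.
- exact: Lfun2_integrableM.
- exact: (integrableB measurableT (LF2 _ Df) iccff).
rewrite RintegralB//; last exact: LF2.
rewrite RintegralZl//; last exact: Lfun2_integrableM.
rewrite RintegralZl// -/v -cc.
set I := (\int[Q]_y (F y * f y))%R; set J := (\int[Q]_y (f y * f y))%R in f2 *.
move=> h; have : (c * (c + c * J - 2 * I) >= 0)%R by lra.
rewrite pmulr_rge0// => h2.
have : (c * J <= c)%R by rewrite ler_piMr// ltW.
by lra.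
Qed.

Definition optimal_test (y : N.-tuple Omega) : R := ((Num.sqrt v)^-1 * F y)%R.

Lemma optimal_test_function : test_functions K D optimal_test.
Proof.
have v0 : (0 < v)%R by exact: lt_le_trans low_degree_norm_ge1.
split; first exact: degree_space_scale.
rewrite unlock (_ : integral _ _ _ = 1)//.
transitivity (\int[Q]_y ((v^-1)%:E * (F y * F y)%:E)).
  apply: eq_integral => y _; rewrite -EFinM; congr EFin.
  by rewrite /optimal_test exprMn exprVn sqr_sqrtr ?expr2// ltW.
rewrite integralZl//; last exact: Lfun2_integrableM.
have -> : \int[Q]_y (F y * F y)%:E = v%:E.
  rewrite /v /Rintegral fineK//.
  exact/integrable_fin_num/Lfun2_integrableM.
by rewrite -EFinM mulVf// gt_eqF.
Qed.

Lemma integral_optimal_test : (\int[PL]_y optimal_test y = Num.sqrt v)%R.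
Proof.
have v0 : (0 < v)%R by exact: lt_le_trans low_degree_norm_ge1.
have [Df _] := optimal_test_function.
rewrite -(low_degree_part_test Df) /optimal_test.
under eq_Rintegral do rewrite mulrCA.
rewrite RintegralZl//; last exact: Lfun2_integrableM.
rewrite -/v; set c := Num.sqrt v.
have c0 : (0 < c)%R by rewrite sqrtr_gt0.
have <- : (c * c = v)%R by rewrite -expr2 sqr_sqrtr// ltW.
by rewrite mulKf// gt_eqF.
Qed.

Lemma expectation_planted f : degree_space K D f ->
  'E_PL[f] = (\int[PL]_y f y)%R%:E.
Proof.
move=> Df; rewrite expectation_Rintegral//.
by apply: planted_integrable; exact: degree_space_Lfun2 Df.
Qed.

Lemma CAdvE : CAdv K X D = (Num.sqrt v)%:E.
Proof.
apply/eqP; rewrite eq_le; apply/andP; split.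
  apply: ge_ereal_sup => _ [f Tf <-].
  rewrite expectation_planted; last by case: Tf.
  by rewrite lee_fin; exact: test_functions_le.
apply: ereal_sup_ubound; exists optimal_test; first exact: optimal_test_function.
rewrite expectation_planted; last by case: optimal_test_function.
by rewrite integral_optimal_test.
Qed.

Lemma CAdv_attained :
  exists2 f, test_functions K D f & CAdv K X D = 'E_PL[f].
Proof.
exists optimal_test; first exact: optimal_test_function.
rewrite expectation_planted; last by case: optimal_test_function.
by rewrite integral_optimal_test CAdvE.
Qed.

Lemma CAdv_sqr : CAdv K X D ^+ 2 = 'E_(X \x X)[low_degree_overlap D].
Proof.
have v0 : (0 < v)%R by exact: lt_le_trans low_degree_norm_ge1.
rewrite CAdvE expectation_Rintegral; last exact: integrable_low_degree_overlap.
by rewrite integral_low_degree_overlap -EFin_expe sqr_sqrtr// ltW.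
Qed.

End attained.

End low_degree_projection.

(** * The truncated exponential of the overlaps *)
Section bounded_below.
Context d (T : measurableType d) (R : realType) (P : probability T R).

Lemma integral_bounded_below_eqy (f : T -> R) (c : R) : measurable_fun setT f ->
  (forall x, - c <= f x)%R -> ~ P.-integrable setT (EFin \o f) ->
  \int[P]_x (f x)%:E = +oo.
Proof.
move=> mf fc nint.
have mfE : measurable_fun setT (EFin \o f) by exact/measurable_EFinP.
have neg_fin : \int[P]_x (EFin \o f)^\- x \is a fin_num.
  rewrite ge0_fin_numE; last exact: integral_ge0.
  apply: (@le_lt_trans _ _ (\int[P]_x `|c|%:E)); last first.
    by rewrite integral_cst_probability ltry.
  apply: ge0_le_integral => //.
  - exact: measurable_funeneg.
  - move=> x _; rewrite funenegE/= ge_max !lee_fin normr_ge0 andbT.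
    by rewrite lerNl (le_trans _ (fc x))// lerN2 ler_norm.
rewrite integralE -[X in X - _](_ : +oo = _); first by rewrite -(fineK neg_fin).
apply/esym/eqP; rewrite -leye_eq leNgt; apply/negP => pos_fin.
apply: nint; apply/integrableP; split => //.
rewrite -[X in integral _ _ X]/(abse \o (EFin \o f)) fune_abse.
rewrite ge0_integralD//; [|exact: measurable_funepos|exact: measurable_funeneg].
by rewrite lte_add_pinfty// -ge0_fin_numE//; exact: integral_ge0.
Qed.

End bounded_below.

Section exponential_bounds.
Context (R : realType) (N : nat) (o : 'I_N -> R).
Hypothesis oN1 : forall i, (0 <= 1 + o i)%R.
Local Open Scope ring_scope.
Local Notation s := (\sum_(i < N) o i).

Let sN : - N%:R <= s.
Proof.
have : 0 <= \sum_(i < N) (1 + o i) by apply: sumr_ge0.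
by rewrite big_split/= sumr_const card_ord -lerBlDl sub0r.
Qed.

(** As the other summands are at least [-1], no summand can be large without
    the sum being large. *)
Lemma summand_le i : `|o i| <= `|s| + N.+1%:R.
Proof.
have so : o i <= s + N%:R.
  have : 0 <= \sum_(j < N | j != i) (1 + o j) by apply: sumr_ge0.
  have := bigD1 i isT : \sum_(j < N) (1 + o j) = _.
  rewrite big_split/= sumr_const card_ord => /= e1 e2.
  by have := oN1 i; lra.
have := ler_norm s; have := oN1 i; rewrite -natr1 => h1 h2.
have : 0 <= `|s| by [].
have : 0 <= N%:R :> R by [].
rewrite ler_norml; lra.
Qed.

Lemma exp_le_ge0 D (t : R) : 0 <= t -> 0 <= exp_le D t.
Proof. by move=> t0; apply: sumr_ge0 => k _; rewrite divr_ge0// exprn_ge0. Qed.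

(** The sum is at least [- N]; on nonnegative arguments the truncated
    exponential is nonnegative, and on [[- N, 0]] its absolute value is at most
    its value at [N]. *)
Lemma exp_le_ge D : - exp_le D N%:R <= exp_le D s.
Proof.
have [s0|s0] := leP 0 s.
  by rewrite (@le_trans _ _ 0) ?oppr_le0 ?exp_le_ge0.
rewrite lerNl; apply: le_trans (ler_norm _) _; rewrite normrN.
apply: le_trans (ler_norm_sum _ _ _) _; apply: ler_sum => k _.
rewrite normrM normrX [`|_^-1|]ger0_norm// ler_wpM2r//.
by apply: lerXn2r; rewrite ?nnegrE// ltr0_norm//; rewrite lerNl.
Qed.

(** When the sum exceeds [N + 1] the left side is at most [(2 s) ^+ D], which
    the top term of the exponential controls; otherwise it is bounded. *)
Lemma pow_le_exp_le D :
  (`|s| + N.+1%:R) ^+ D <=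
  (2 ^+ D * D`!%:R) * `|exp_le D s| + (2 * N.+1%:R) ^+ D.
Proof.
have N0 : 0 <= N.+1%:R :> R by [].
have [s0|s0] := leP 0 s; last first.
  rewrite -[leLHS]add0r; apply: lerD; first by rewrite !mulr_ge0// exprn_ge0.
  apply: lerXn2r; rewrite ?nnegrE ?addr_ge0 ?mulr_ge0//.
  have := sN; rewrite ltr0_norm// -natr1; lra.
rewrite ger0_norm//.
have sE : s ^+ D <= D`!%:R * `|exp_le D s|.
  rewrite -ler_pdivrMl ?ltr0n ?fact_gt0// mulrC.
  rewrite ger0_norm ?exp_le_ge0//.
  rewrite /exp_le (bigD1 ord_max)//= lerDl; apply: sumr_ge0 => k _.
  by rewrite divr_ge0// exprn_ge0.
have [sN'|sN'] := leP s N.+1%:R.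
  rewrite -[leLHS]add0r; apply: lerD; first by rewrite !mulr_ge0// exprn_ge0.
  by apply: lerXn2r; rewrite ?nnegrE ?addr_ge0 ?mulr_ge0//; lra.
rewrite -[leLHS]addr0; apply: lerD; last by rewrite exprn_ge0// mulr_ge0.
rewrite -mulrA; apply: (@le_trans _ _ (2 ^+ D * s ^+ D)); last first.
  by rewrite ler_wpM2l// exprn_ge0.
rewrite -exprMn; apply: lerXn2r; rewrite ?nnegrE ?addr_ge0 ?mulr_ge0//; lra.
Qed.

Lemma monomial_le D k (f : 'I_k -> 'I_N) : (k <= D)%N ->
  `|\prod_(j < k) o (f j)| <=
  (2 ^+ D * D`!%:R) * `|exp_le D s| + (2 * N.+1%:R) ^+ D.
Proof.
move=> kD; apply: le_trans (pow_le_exp_le D).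
apply: (@le_trans _ _ ((`|s| + N.+1%:R) ^+ k)).
  rewrite normr_prod -[X in _ ^+ X]card_ord -prodr_const.
  by apply: ler_prod => j _; rewrite normr_ge0 summand_le.
apply: ler_weXn2l => //.
by rewrite -natr1 addrA lerDr addr_ge0.
Qed.

End exponential_bounds.

Section exponential_bound.
Context {R : realType} {Sigma : set R} {Sigma0 : Sigma 0%R}.
Context {d : measure_display} {Omega : measurableType d}.
Variables (K : R.-pker (alphabet Sigma0) ~> Omega) (N : nat).
Variable X : probability (N.-tuple (alphabet Sigma0)) R.
Local Notation P0 := (channel_law K (letter0 Sigma0)).

Variable p : alphabet Sigma0 -> Omega -> R.
Hypothesis hp : ratio_version K p.
Hypothesis ratio_L2 : forall a, likelihood_ratio K a \in Lfun P0 2%:E.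
Hypothesis moverlap : measurable_fun [set: alphabet Sigma0 * alphabet Sigma0]
  (fun ab => overlap K ab.1 ab.2).

Local Notation pairs :=
  (N.-tuple (alphabet Sigma0) * N.-tuple (alphabet Sigma0))%type.
Let o (q : pairs) (i : 'I_N) := overlap K (tnth q.1 i) (tnth q.2 i).

Let oN1 q i : (0 <= 1 + o q i)%R.
Proof. exact: (overlap_geN1 hp ratio_L2). Qed.

(** The overlap is the Gram kernel of the centered likelihood ratios. *)
Lemma monomial_integral_ge0 k (f : 'I_k -> 'I_N) :
  (X \x X).-integrable setT (fun q => (\prod_(j < k) o q (f j))%R%:E) ->
  (0 <= \int[X \x X]_q \prod_(j < k) o q (f j))%R.
Proof.
apply: (@psd_integral_ge0 _ _ _ X (fun a b =>
  \prod_(j < k) overlap K (tnth a (f j)) (tnth b (f j)))%R).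
have := psd_prod_gram (fun j (a : N.-tuple (alphabet Sigma0)) => tnth a (f j))
  (centered_ratio_Lfun2 hp ratio_L2).
move=> h n a c; have := h n a c; congr (_ <= _)%R.
apply: eq_bigr => i _; apply: eq_bigr => j _; congr (_ * _)%R.
by apply: eq_bigr => l _; rewrite (overlapE hp ratio_L2).
Qed.

Let E D (q : pairs) : R := exp_le D (\sum_(i < N) o q i)%R.

Lemma measurable_monomial k (f : 'I_k -> 'I_N) :
  measurable_fun setT (fun q => \prod_(j < k) o q (f j))%R.
Proof.
by apply: measurable_prod => j _; exact: measurable_tuple_overlap.
Qed.

Lemma measurable_exp_overlap D : measurable_fun setT (E D).
Proof.
apply: measurable_sum => j; apply: measurable_funM => //.
apply: measurable_funX; apply: measurable_sum => i.
exact: measurable_tuple_overlap.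
Qed.

Lemma integrable_monomial D k (f : 'I_k -> 'I_N) : (k <= D)%N ->
  (X \x X).-integrable setT (EFin \o E D) ->
  (X \x X).-integrable setT (EFin \o (fun q => \prod_(j < k) o q (f j))%R).
Proof.
move=> kD iE; set c1 : R := (2 ^+ D * D`!%:R)%R.
set c2 : R := ((2 * N.+1%:R) ^+ D)%R.
have ib : (X \x X).-integrable setT
    (fun q => c1%:E * `|(EFin \o E D) q| + (EFin \o cst c2) q).
  apply: integrableD => //.
    by apply: integrableZl => //; exact: integrable_abse.
  exact: (finite_measure_integrable_cst (X \x X : probability pairs R)).
apply: le_integrable ib => //.
  by apply/measurable_EFinP; exact: measurable_monomial.
move=> q _; rewrite /= lee_fin.
apply: le_trans (ler_norm _); exact: monomial_le.
Qed.

Lemma low_degree_overlap_le_exp D :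
  (X \x X).-integrable setT
    (EFin \o (low_degree_overlap K D : pairs -> R)) ->
  'E_(X \x X)[low_degree_overlap K D] <= 'E_(X \x X)[E D].
Proof.
move=> il.
(* Without integrability, the right side is infinite. *)
have [iE|niE] := pselect ((X \x X).-integrable setT (EFin \o E D)); last first.
  rewrite unlock [leRHS](integral_bounded_below_eqy (f := E D)
    (c := exp_le D N%:R)) ?leey//.
    exact: measurable_exp_overlap.
  by move=> q; exact: exp_le_ge.
rewrite !expectation_Rintegral// lee_fin.
have im (k : 'I_D.+1) (f : {ffun 'I_k -> 'I_N}) : (X \x X).-integrable setT
    (EFin \o (fun q => \prod_(j < k) o q (f j))%R).
  by apply: integrable_monomial iE; rewrite -ltnS.
pose rest k q : R := (\sum_(f : {ffun 'I_k -> 'I_N} | ~~ injectiveb f)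
     (k`!)%:R^-1 * \prod_j o q (f j))%R.
have irest (k : 'I_D.+1) : (X \x X).-integrable setT (EFin \o rest k).
  by apply: integrable_lincomb => f _; exact: im.
have iR : (X \x X).-integrable setT (EFin \o (fun q => \sum_(k < D.+1) rest k q)%R).
  have -> : EFin \o (fun q => \sum_(k < D.+1) rest k q)%R =
      (fun q => \sum_(k < D.+1) (EFin \o rest k) q).
    by apply/funext => q; rewrite sumEFin.
  exact: integrable_sum.
have -> : (\int[X \x X]_q E D q =
    \int[X \x X]_q (low_degree_overlap K D q + \sum_(k < D.+1) rest k q))%R.
  by apply: eq_Rintegral => q _; exact: exp_le_expand.
rewrite RintegralD// lerDl Rintegral_sum//; apply: sumr_ge0 => k _.
rewrite Rintegral_lincomb => [|f _]; last exact: im.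
apply: sumr_ge0 => f _; rewrite mulr_ge0//.
by apply: monomial_integral_ge0; exact: im.
Qed.

End exponential_bound.

Theorem theorem3p5 (R : realType) (Sigma : set R) (Sigma0 : Sigma 0%R)
    (d : measure_display) (Omega : measurableType d) (N : nat)
    (X : probability (N.-tuple (alphabet Sigma0)) R)
    (K : R.-pker (alphabet Sigma0) ~> Omega) (D : nat)
    (N_ge1 : (1 <= N)%N) (XK_good : good K X)
    (measurable_overlap :
      measurable_fun [set: alphabet Sigma0 * alphabet Sigma0]
        (fun ab => overlap K ab.1 ab.2)) :
  [/\ exists2 f, test_functions K D f & CAdv K X D = 'E_(planted_law K X)[f],
      CAdv K X D ^+ 2 =
        'E_(X \x X)[fun x =>
          (\sum_(T : {set 'I_N} | (#|T| <= D)%N)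
             \prod_(i in T) overlap K (tnth x.1 i) (tnth x.2 i))%R]
    & 'E_(X \x X)[fun x =>
          (\sum_(T : {set 'I_N} | (#|T| <= D)%N)
             \prod_(i in T) overlap K (tnth x.1 i) (tnth x.2 i))%R] <=
        'E_(X \x X)[fun x =>
          exp_le D (\sum_(i < N) overlap K (tnth x.1 i) (tnth x.2 i))%R]].
Proof.
have [_ dom ratio_L2 domPL LPL2] := XK_good.
have [L [mL L0 aeL dL]] := has_densityP domPL.
have LL2 : L \in Lfun (null_law K N) 2%:E := ae_eq_Lfun2 mL aeL LPL2.
have [p hp] := ratio_version_ex dom.
split.
- exact: (CAdv_attained mL L0 dL LL2).
- exact: (CAdv_sqr mL L0 dL LL2 hp ratio_L2 measurable_overlap).
- apply: (low_degree_overlap_le_exp hp ratio_L2 measurable_overlap).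
  exact: (integrable_low_degree_overlap mL L0 dL LL2 hp ratio_L2).
Qed.
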